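(* For each $\nu>-1$ the radius of convexity $r^c(v_\nu)$ satisfies $r^c(v_\nu)<\sqrt[4]{\frac{4(\nu+1)^2(\nu+2)}{5}}$. Moreover, if $\nu>-1$, then $$2\sqrt[4]{\frac{(\nu+1)^2(\nu+2)}{25}}<r^c(v_\nu)<2\sqrt[4]{\frac{25(\nu+1)(\nu+1)_4}{\nu_{17}}}$$ and $$2\sqrt[8]{\frac{(\nu+1)_4(\nu+1)^3(\nu+2)}{\nu_{17}}}<r^c(v_\nu)<\sqrt[4]{\frac{8(\nu+1)(\nu+1)_3(\nu+5)_2\,\nu_{17}}{\nu_{18}}},$$ where $$\nu_{17}=544\nu^2+4213\nu+7419$$ and $$\nu_{18}=6336\nu^5+140016\nu^4+1212429\nu^3+5112301\nu^2+10459449\nu+8300897.$$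
   Context: For $\nu>-1$, with $J_\nu,I_\nu$ the Bessel and modified Bessel functions of the first kind, $$\mathbf{\Pi}_\nu(z)=J_\nu(z)I_\nu(z)=\sum_{n\ge0}\frac{(-1)^n(z/2)^{2\nu+4n}}{n!\,\Gamma(\nu+n+1)\Gamma(\nu+2n+1)},$$ $$v_\nu(z)=2^{2\nu}z^{-2\nu+1}\Gamma^2(\nu+1)\mathbf{\Pi}_\nu(z)=\sum_{n\ge0}\frac{(-1)^n z^{4n+1}}{2^{4n}n!\,(\nu+1)_n(\nu+1)_{2n}}.$$ The radius of convexity is $r^c(f)=\sup\{r>0:\operatorname{Re}(1+zf''(z)/f'(z))>0\text{ for all }|z|<r\}$. Pochhammer symbol: $(a)_0=1$, $(a)_n=a(a+1)\cdots(a+n-1)$. *)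

(* Defs.v *)
From Stdlib Require Import Reals Factorial.
From Coquelicot Require Import Coquelicot.
Open Scope R_scope.

(* Euler's integral; it converges exactly when [0 < x]. *)
Definition Gamma (x : R) : R :=
  RInt_gen (fun t => Rpower t (x - 1) * exp (- t))
           (at_right 0) (Rbar_locally p_infty).

Fixpoint pochhammer (a : R) (n : nat) : R :=
  match n with
  | O => 1
  | S m => pochhammer a m * (a + INR m)
  end.

(* Principal argument, in (-PI, PI], for [z <> 0]. *)
Definition Carg (z : C) : R :=
  if Rle_dec 0 (Im z) then acos (Re z / Cmod z) else - acos (Re z / Cmod z).

Definition Cexp (z : C) : C :=
  (exp (Re z) * cos (Im z), exp (Re z) * sin (Im z)).

Definition Clog (z : C) : C := (ln (Cmod z), Carg z).

(* Principal value of [z] to the real power [s], with the conventions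
   0 ^ 0 = 1 and 0 ^ s = 0 for [s <> 0]. *)
Definition Cpower (z : C) (s : R) : C :=
  if Ceq_dec z 0 then (if Req_dec_T s 0 then RtoC 1 else RtoC 0)
  else Cexp (RtoC s * Clog z)%C.

Definition CSeries (a : nat -> C) : C :=
  (Series (fun n => Re (a n)), Series (fun n => Im (a n))).

Definition BesselJ (nu : R) (z : C) : C :=
  (Cpower (z / 2) nu *
   CSeries (fun n =>
     RtoC ((-1) ^ n / (INR (fact n) * Gamma (nu + INR n + 1)))
     * (z / 2) ^ (2 * n)))%C.

Definition BesselI (nu : R) (z : C) : C :=
  (Cpower (z / 2) nu *
   CSeries (fun n =>
     RtoC (1 / (INR (fact n) * Gamma (nu + INR n + 1)))
     * (z / 2) ^ (2 * n)))%C.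

Definition BesselProd (nu : R) (z : C) : C := (BesselJ nu z * BesselI nu z)%C.

(* For [-1 < nu] this is the entire function z + O(z^5).  The branch cuts of
   the powers cancel: z^(-2nu+1) (z/2)^nu (z/2)^nu = 2^(-2nu) z for every
   [z <> 0].  At the origin the conventions of [Cpower] give the removable
   value 0 (for nu = 0 and nu = 1/2 as well). *)
Definition v (nu : R) (z : C) : C :=
  (RtoC (Rpower 2 (2 * nu)) * Cpower z (-2 * nu + 1)
   * RtoC (Gamma (nu + 1) ^ 2) * BesselProd nu z)%C.

(* [C_derive f z <> 0] says that the quotient f''/f' is defined, which is
   implicit in the inequality since division is total here.  [C_derive] is a
   total operator: it is the complex derivative when [f] is holomorphic. *)
Definition convex_in_disk (f : C -> C) (r : R) : Prop :=
  forall z : C, Cmod z < r ->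
    C_derive f z <> RtoC 0 /\
    0 < Re (1 + z * C_derive (C_derive f) z / C_derive f z)%C.

Definition radius_of_convexity (f : C -> C) : Rbar :=
  Lub_Rbar (fun r => 0 < r /\ convex_in_disk f r).

(* The [k]-th root of [x], for [0 < x]. *)
Definition nth_root (k : nat) (x : R) : R := Rpower x (/ INR k).

Definition nu17 (nu : R) : R := 544 * nu ^ 2 + 4213 * nu + 7419.

Definition nu18 (nu : R) : R :=
  6336 * nu ^ 5 + 140016 * nu ^ 4 + 1212429 * nu ^ 3 + 5112301 * nu ^ 2
  + 10459449 * nu + 8300897.

(* Main.v *)
Require Import Defs.
From Stdlib Require Import Reals Factorial Lra Lia Psatz List.
From Coquelicot Require Import Coquelicot.
Open Scope R_scope.

(** Write a = nu + 1 and w = z^4.  The function is v(z) = z G(w) with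
G(w) = sum (-1)^n g_n w^n and g_n = 1 / (16^n n! (a)_n (a)_(2n)), so that v'(z) = phi(w)
with coefficients b_n = (4n+1) g_n, and 1 + z v'' / v' = 1 + 4 w phi'(w) / phi(w).
At a real point w = r this quotient is Phi(r) / phi(r), where
Phi(r) = sum (-1)^n c_n r^n and c_n = (4n+1)^2 g_n.

The usual argument factors phi over its zeros, which are real and positive.  Here the
distribution of zeros is avoided.  All that the factorization would give is that
-w phi'/phi has nonnegative Taylor coefficients (the power sums of the reciprocal zeros),
and for w in the disk of radius 1/b_1 this follows from the rapid decay
b_(n+1) <= (b_1/4) b_n, n >= 1: the coefficients q_n of 1/phi satisfy a recurrence whose
alternating terms decrease, which keeps q_(n+1)/q_n between b_1/2 and b_1, and the
coefficients of -w phi'/phi are alternating sums of the same kind (recip_bounds,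
logderiv_bounds).  Consequently phi does not vanish there, and the minimum of
Re (1 + 4 w phi'/phi) on the circle |w| = r is attained at w = r, where it has the sign of
Phi(r) (Re_log_derivative_min, Re_log_derivative_sign).  Hence the radius of convexity
exceeds y when, within that disk, Phi > 0 at some real w > y^4, and is less than y when
Phi < 0 at some 0 < w < y^4.

It remains to locate the sign change of Phi.  Put x = c_1 w, t = c_2 / c_1^2,
s = c_3 / c_1^3, q = c_4 / c_1^4; alternation gives
1 - x + t x^2 - s x^3 <= Phi <= 1 - x + t x^2 - s x^3 + q x^4.  By Newton's identities the
power sums of the reciprocal zeros of Phi are c_1, c_1^2 (1 - 2t), c_1^3 (1 - 3t + 3s), so
that the Euler-Rayleigh bounds are the points x = (1 - 2t)^(-1/2) from below and
x = (1 - 2t) / (1 - 3t + 3s) from above, and the other three bounds are weaker.  The signs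
of Phi there are polynomial inequalities in t and s (rayleigh_lower_pos,
rayleigh_upper_neg), valid since t <= 81/1250 and s <= 0.43 t^2 for every nu.

Two preliminaries connect this with the definition of v.  Euler's integral must be shown
to converge, to be positive and to satisfy Gamma (x + 1) = x Gamma x, which turns the
Bessel coefficients into Pochhammer symbols; and the Cauchy product of the two Bessel
series must be evaluated, which is a terminating case of Kummer's theorem
(kummer_sum_odd, kummer_sum_even). *)

(** * Euler's integral *)

Lemma exp_le_compat (x y : R) : x <= y -> exp x <= exp y.
Proof. intros [H| ->]; [now apply Rlt_le, exp_increasing|apply Rle_refl]. Qed.

(** For a nonnegative integrand the integrals over [a, b] increase as the interval
    grows, so their supremum is the limit at both endpoints at once. The second
    conclusion serves to bound the limit from below. *)
Lemma is_RInt_gen_sup (f : R -> R) (M : R) :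
  (forall t, 0 < t -> continuous f t) ->
  (forall t, 0 < t -> 0 <= f t) ->
  (forall a b, 0 < a -> a <= b -> RInt f a b <= M) ->
  exists l, is_RInt_gen f (at_right 0) (Rbar_locally p_infty) l
    /\ forall a b, 0 < a -> a <= b -> RInt f a b <= l.
Proof.
  intros Hc Hp HM.
  assert (Hex : forall a b, 0 < a -> a <= b -> ex_RInt f a b).
  { intros a b Ha Hab. apply (ex_RInt_continuous (V := R_CompleteNormedModule)).
    intros z Hz. apply Hc. rewrite Rmin_left in Hz; lra. }
  assert (Hpos : forall a b, 0 < a -> a <= b -> 0 <= RInt f a b).
  { intros a b Ha Hab. apply RInt_ge_0; auto. intros x Hx; apply Hp; lra. }
  destruct (completeness (fun y => exists a b, 0 < a /\ a <= b /\ y = RInt f a b))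
    as [l [Hub Hlub]].
  { exists M. intros y (a & b & Ha & Hab & ->). auto. }
  { exists (RInt f 1 1), 1, 1. repeat split; lra. }
  assert (Hle : forall a b, 0 < a -> a <= b -> RInt f a b <= l).
  { intros a b Ha Hab. apply Hub. now exists a, b. }
  exists l. split; [|exact Hle].
  intros P [eps HP].
  assert (Hlt : exists a0 b0, 0 < a0 /\ a0 <= b0 /\ l - eps < RInt f a0 b0).
  { apply Classical_Prop.NNPP. intros Hn.
    assert (l <= l - eps); [|destruct eps; simpl in *; lra].
    apply Hlub. intros y (a & b & Ha & Hab & ->).
    apply Rnot_lt_le. intros Hlt. apply Hn. exists a, b. auto. }
  destruct Hlt as (a0 & b0 & Ha0 & Hab0 & Hlt).
  apply (Filter_prod _ _ _ (fun a => 0 < a < a0) (fun b => b0 < b)).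
  - exists (mkposreal a0 Ha0). intros y Hy Hy0. split; [exact Hy0|].
    unfold ball in Hy; simpl in Hy; unfold AbsRing_ball, abs, minus, plus, opp in Hy;
      simpl in Hy. apply Rabs_def2 in Hy. lra.
  - exists b0. auto.
  - intros a b Ha Hb. simpl. exists (RInt f a b). split.
    + apply (RInt_correct (V := R_CompleteNormedModule)), Hex; lra.
    + apply HP. unfold ball; simpl; unfold AbsRing_ball, abs, minus, plus, opp; simpl.
      assert (E : RInt f a b = RInt f a a0 + (RInt f a0 b0 + RInt f b0 b)).
      { assert (E1 : RInt f a0 b = RInt f a0 b0 + RInt f b0 b).
        { symmetry. apply (RInt_Chasles f a0 b0 b); apply Hex; lra. }
        rewrite <- E1. symmetry. apply (RInt_Chasles f a a0 b); apply Hex; lra. }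
      generalize (Hle a b ltac:(lra) ltac:(lra)) (Hpos a a0 ltac:(lra) ltac:(lra))
        (Hpos b0 b ltac:(lra) ltac:(lra)). intros.
      apply Rabs_def1; lra.
Qed.

Definition gamma_integrand (x t : R) : R := Rpower t (x - 1) * exp (- t).

Lemma Rpower_continuous (s t : R) : 0 < t -> continuous (fun t => Rpower t s) t.
Proof.
  intros Ht. apply continuous_comp with (f := fun t => s * ln t) (g := exp).
  - apply (continuous_scal_r s ln). apply continuity_pt_filterlim.
    apply derivable_continuous_pt. exists (/ t). now apply derivable_pt_lim_ln.
  - apply continuity_pt_filterlim, derivable_continuous_pt, derivable_pt_exp.
Qed.

Lemma gamma_integrand_continuous (x t : R) :
  0 < t -> continuous (gamma_integrand x) t.
Proof.
  intros Ht. apply (continuous_mult (fun t => Rpower t (x - 1)) (fun t => exp (- t))).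
  - now apply Rpower_continuous.
  - apply (ex_derive_continuous (K := R_AbsRing) (V := R_NormedModule)). auto_derive. auto.
Qed.

Lemma gamma_integrand_pos (x t : R) : 0 < gamma_integrand x t.
Proof. apply Rmult_lt_0_compat; apply exp_pos. Qed.

Lemma gamma_integrand_S (x t : R) :
  0 < t -> gamma_integrand (x + 1) t = t * gamma_integrand x t.
Proof.
  intros Ht. unfold gamma_integrand.
  replace (x + 1 - 1) with ((x - 1) + 1) by ring.
  rewrite Rpower_plus, Rpower_1 by assumption. ring.
Qed.

(** From ln u <= u with u = t / (2 x): the factor t^x costs at most half of the
    exponential decay. *)
Lemma gamma_integrand_decay (x t : R) :
  0 < x -> 0 < t ->
  gamma_integrand (x + 1) t <= Rpower (2 * x) x * exp (- t / 2).
Proof.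
  intros Hx Ht. unfold gamma_integrand, Rpower. rewrite <- !exp_plus.
  apply exp_le_compat.
  replace (x + 1 - 1) with x by ring.
  assert (H : ln (t / (2 * x)) <= t / (2 * x)).
  { apply Rlt_le. rewrite <- (ln_exp (t / (2 * x))) at 2. apply ln_increasing.
    - apply Rdiv_lt_0_compat; lra.
    - generalize (exp_ineq1 (t / (2 * x))). intros H.
      assert (0 < t / (2 * x)) by (apply Rdiv_lt_0_compat; lra). lra. }
  unfold Rdiv in H. rewrite ln_mult, ln_Rinv in H;
    try apply Rinv_0_lt_compat; try lra.
  apply (Rmult_le_compat_l x) in H; [|lra].
  replace (x * (t * / (2 * x))) with (t / 2) in H by (field; lra).
  nra.
Qed.

Lemma is_derive_gamma_integrand (x t : R) :
  0 < t ->
  is_derive (gamma_integrand (x + 1)) t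
            (x * gamma_integrand x t - gamma_integrand (x + 1) t).
Proof.
  intros Ht. rewrite gamma_integrand_S by assumption.
  unfold gamma_integrand, Rpower.
  replace (x + 1 - 1) with x by ring.
  auto_derive; [assumption|].
  replace (x * ln t) with ((x - 1) * ln t + ln t) by ring.
  rewrite exp_plus, exp_ln by assumption. field. lra.
Qed.

(** Since (t^x exp (-t))' = x t^(x-1) exp (-t) - t^x exp (-t), the integrand is a
    derivative of a bounded function plus t^x exp (-t) / x, which decays exponentially.
    This treats the singularity at 0 and the tail together. *)
Lemma RInt_gamma_integrand_bound (x a b : R) :
  0 < x -> 0 < a -> a <= b ->
  RInt (gamma_integrand x) a b <= 3 * Rpower (2 * x) x / x.
Proof.
  intros Hx Ha Hab. set (C := Rpower (2 * x) x).
  assert (HC : 0 < C) by apply exp_pos.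
  set (A := fun t => gamma_integrand (x + 1) t / x - 2 * C / x * exp (- t / 2)).
  set (dA := fun t => gamma_integrand x t - gamma_integrand (x + 1) t / x
                      + C / x * exp (- t / 2)).
  assert (HA : forall t, 0 < t -> is_derive A t (dA t)).
  { intros t Ht. unfold A, dA.
    replace (gamma_integrand x t - gamma_integrand (x + 1) t / x + C / x * exp (- t / 2))
      with (minus ((x * gamma_integrand x t - gamma_integrand (x + 1) t) * / x)
                  (- (C / x) * exp (- t / 2))).
    2: { unfold minus, plus, opp; simpl. field. lra. }
    apply (is_derive_minus (fun t => gamma_integrand (x + 1) t / x)).
    - unfold Rdiv.
      apply (is_derive_ext (fun t => scal (/ x) (gamma_integrand (x + 1) t))).
      { intros; unfold scal; simpl; unfold mult; simpl; ring. }
      replace ((x * gamma_integrand x t - gamma_integrand (x + 1) t) * / x)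
        with (scal (/ x) (x * gamma_integrand x t - gamma_integrand (x + 1) t))
        by (unfold scal; simpl; unfold mult; simpl; ring).
      apply is_derive_scal, is_derive_gamma_integrand, Ht.
    - auto_derive; auto. unfold Rdiv. field. lra. }
  assert (HdA : forall t, 0 < t -> continuous dA t).
  { intros t Ht. unfold dA.
    apply (continuous_plus (fun t => gamma_integrand x t - gamma_integrand (x + 1) t / x)).
    - apply (continuous_minus (gamma_integrand x)).
      + now apply gamma_integrand_continuous.
      + apply (continuous_mult (gamma_integrand (x+1)) (fun _ => / x)).
        * now apply gamma_integrand_continuous.
        * apply continuous_const.
    - apply (ex_derive_continuous (K := R_AbsRing) (V := R_NormedModule)). auto_derive. auto. }
  assert (HI : is_RInt dA a b (minus (A b) (A a))).
  { apply (is_RInt_derive (V := R_CompleteNormedModule) A dA);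
      intros t Ht; rewrite Rmin_left, Rmax_right in Ht by lra.
    - apply HA; lra.
    - apply HdA; lra. }
  apply Rle_trans with (RInt dA a b).
  - apply RInt_le; auto.
    + apply (ex_RInt_continuous (V := R_CompleteNormedModule)). intros z Hz.
      rewrite Rmin_left in Hz by lra. apply gamma_integrand_continuous; lra.
    + now exists (minus (A b) (A a)).
    + intros t Ht. unfold dA.
      assert (H := gamma_integrand_decay x t Hx ltac:(lra)). fold C in H.
      assert (gamma_integrand (x + 1) t / x <= C / x * exp (- t / 2)); [|lra].
      unfold Rdiv. rewrite (Rmult_comm C), Rmult_assoc, (Rmult_comm _ (/ x)).
      apply Rmult_le_compat_l; [apply Rlt_le, Rinv_0_lt_compat; lra|]. exact H.
  - rewrite (is_RInt_unique _ _ _ _ HI). unfold minus, plus, opp; simpl. unfold A.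
    assert (H := gamma_integrand_decay x b Hx ltac:(lra)). fold C in H.
    assert (Hb := gamma_integrand_pos (x + 1) a).
    assert (He : forall t, 0 < t -> exp (- t / 2) <= 1).
    { intros t Ht. rewrite <- exp_0. apply exp_le_compat. lra. }
    assert (Heb := He b ltac:(lra)). assert (Hea := He a ltac:(lra)).
    assert (Hpb := exp_pos (- b / 2)).
    apply Rmult_le_reg_r with x; [assumption|]. unfold Rdiv. field_simplify; try lra.
    nra.
Qed.

Lemma Gamma_sup (x : R) :
  0 < x ->
  is_RInt_gen (gamma_integrand x) (at_right 0) (Rbar_locally p_infty) (Gamma x)
  /\ forall a b, 0 < a -> a <= b -> RInt (gamma_integrand x) a b <= Gamma x.
Proof.
  intros Hx.
  destruct (is_RInt_gen_sup (gamma_integrand x) (3 * Rpower (2 * x) x / x)) as (l & Hl & Hle).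
  - apply gamma_integrand_continuous.
  - intros; apply Rlt_le, gamma_integrand_pos.
  - intros; now apply RInt_gamma_integrand_bound.
  - assert (E : Gamma x = l).
    { unfold Gamma. apply is_RInt_gen_unique, Hl. }
    rewrite E. auto.
Qed.

Lemma Gamma_pos (x : R) : 0 < x -> 0 < Gamma x.
Proof.
  intros Hx. apply Rlt_le_trans with (RInt (gamma_integrand x) 1 2).
  - apply RInt_gt_0; try lra.
    + intros; apply gamma_integrand_pos.
    + intros; apply gamma_integrand_continuous; lra.
  - apply Gamma_sup; lra.
Qed.

Lemma gamma_integrand_lim_0 (x : R) :
  0 < x -> filterlim (gamma_integrand (x + 1)) (at_right 0) (locally 0).
Proof.
  intros Hx. apply filterlim_locally. intros eps.
  exists (mkposreal (Rpower eps (/ x)) (exp_pos _)). intros t Ht Ht0.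
  assert (Hlt : t < Rpower eps (/ x)).
  { unfold ball in Ht; simpl in Ht; unfold AbsRing_ball, abs, minus, plus, opp in Ht;
      simpl in Ht. apply Rabs_def2 in Ht. lra. }
  assert (Hpow : Rpower t x < eps).
  { replace (pos eps) with (Rpower (Rpower eps (/ x)) x).
    - apply Rlt_Rpower_l; lra.
    - rewrite Rpower_mult, Rinv_l, Rpower_1; try lra. apply cond_pos. }
  assert (H := gamma_integrand_pos (x + 1) t).
  assert (gamma_integrand (x + 1) t <= Rpower t x).
  { unfold gamma_integrand. replace (x + 1 - 1) with x by ring.
    rewrite <- (Rmult_1_r (Rpower t x)) at 2. apply Rmult_le_compat_l.
    - apply Rlt_le, exp_pos.
    - rewrite <- exp_0. apply exp_le_compat. lra. }
  unfold ball; simpl; unfold AbsRing_ball, abs, minus, plus, opp; simpl.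
  apply Rabs_def1; lra.
Qed.

Lemma gamma_integrand_lim_infty (x : R) :
  0 < x -> filterlim (gamma_integrand (x + 1)) (Rbar_locally p_infty) (locally 0).
Proof.
  intros Hx. apply filterlim_locally. intros eps.
  set (C := Rpower (2 * x) x). assert (HC : 0 < C) by apply exp_pos.
  exists (Rmax 0 (- 2 * ln (eps / C))). intros t Ht.
  assert (Ht0 : 0 < t) by (eapply Rle_lt_trans; [apply Rmax_l|apply Ht]).
  assert (Ht1 : - 2 * ln (eps / C) < t) by (eapply Rle_lt_trans; [apply Rmax_r|apply Ht]).
  assert (He : exp (- t / 2) < eps / C).
  { rewrite <- (exp_ln (eps / C)).
    - apply exp_increasing. lra.
    - apply Rdiv_lt_0_compat; [apply cond_pos|lra]. }
  assert (H := gamma_integrand_pos (x + 1) t).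
  assert (H' := gamma_integrand_decay x t Hx Ht0). fold C in H'.
  apply (Rmult_lt_compat_l C) in He; [|lra].
  replace (C * (eps / C)) with (pos eps) in He by (field; lra).
  unfold ball; simpl; unfold AbsRing_ball, abs, minus, plus, opp; simpl.
  apply Rabs_def1; lra.
Qed.

(** Integration by parts: x t^(x-1) exp (-t) - t^x exp (-t) is the derivative of
    t^x exp (-t), which tends to 0 at both ends. *)
Lemma Gamma_S (x : R) : 0 < x -> Gamma (x + 1) = x * Gamma x.
Proof.
  intros Hx.
  destruct (Gamma_sup x Hx) as [H0 _].
  assert (Hd : is_RInt_gen (Derive (gamma_integrand (x + 1))) (at_right 0)
                 (Rbar_locally p_infty) (0 - 0)).
  { assert (Hprod : filter_prod (at_right 0) (Rbar_locally p_infty)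
              (fun ab : R * R => 0 < fst ab /\ 0 < snd ab)).
    { apply (Filter_prod _ _ _ (fun a => 0 < a) (fun b => 0 < b)).
      - exists (mkposreal 1 Rlt_0_1). auto.
      - exists 0. auto.
      - auto. }
    apply is_RInt_gen_Derive.
    - revert Hprod. apply filter_imp. intros [a b] [Ha Hb] t Ht; simpl in *.
      eexists. apply is_derive_gamma_integrand.
      apply Rlt_le_trans with (2 := proj1 Ht). now apply Rmin_pos.
    - revert Hprod. apply filter_imp. intros [a b] [Ha Hb] t Ht; simpl in *.
      assert (Ht0 : 0 < t).
      { apply Rlt_le_trans with (2 := proj1 Ht). now apply Rmin_pos. }
      apply (continuous_ext_loc _ (fun t => x * gamma_integrand x t - gamma_integrand (x + 1) t)).
      + exists (mkposreal t Ht0). intros y Hy. symmetry. apply is_derive_unique.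
        apply is_derive_gamma_integrand.
        unfold ball in Hy; simpl in Hy; unfold AbsRing_ball, abs, minus, plus, opp in Hy;
          simpl in Hy. apply Rabs_def2 in Hy. lra.
      + apply (continuous_minus (fun t => x * gamma_integrand x t)).
        * apply (continuous_scal_r (V := R_NormedModule) x (gamma_integrand x)).
          now apply gamma_integrand_continuous.
        * now apply gamma_integrand_continuous.
    - now apply gamma_integrand_lim_0.
    - now apply gamma_integrand_lim_infty. }
  assert (H2 := is_RInt_gen_minus _ _ _ _ (is_RInt_gen_scal _ x _ H0) Hd).
  assert (H3 : is_RInt_gen (gamma_integrand (x + 1)) (at_right 0) (Rbar_locally p_infty)
                 (minus (scal x (Gamma x)) (0 - 0))).
  { revert H2. apply is_RInt_gen_ext.
    apply (Filter_prod _ _ _ (fun a => 0 < a) (fun b => 0 < b)).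
    - exists (mkposreal 1 Rlt_0_1). auto.
    - exists 0. auto.
    - intros a b Ha Hb t Ht; simpl in *.
      rewrite (is_derive_unique (gamma_integrand (x + 1)) t
                 (x * gamma_integrand x t - gamma_integrand (x + 1) t)).
      + unfold minus, plus, opp, scal; simpl; unfold mult; simpl. ring.
      + apply is_derive_gamma_integrand.
        apply Rlt_trans with (2 := proj1 Ht). now apply Rmin_pos. }
  change (RInt_gen (gamma_integrand (x + 1)) (at_right 0) (Rbar_locally p_infty)
          = x * Gamma x).
  rewrite (is_RInt_gen_unique _ _ H3).
  unfold minus, plus, opp, scal; simpl; unfold mult; simpl. ring.
Qed.

(** * Complex power series with real coefficients *)

(** Convergence of the two components separately, which is how [CSeries] is defined;
    the real theory of series then applies to each of them. *)
Definition is_cseries (a : nat -> C) (l : C) : Prop :=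
  is_series (fun n => Re (a n)) (Re l) /\ is_series (fun n => Im (a n)) (Im l).

Definition ex_cabs (a : nat -> C) : Prop := ex_series (fun n => Cmod (a n)).

Lemma im_le_Cmod (c : C) : Rabs (Im c) <= Cmod c.
Proof. eapply Rle_trans; [apply Rmax_r|apply Rmax_Cmod]. Qed.

Lemma Cmod_le_Re_Im (c : C) : Cmod c <= Rabs (Re c) + Rabs (Im c).
Proof.
  replace c with (RtoC (Re c) + Ci * RtoC (Im c))%C at 1.
  - eapply Rle_trans; [apply Cmod_triangle|].
    rewrite Cmod_mult, Cmod_Ci, !Cmod_R. lra.
  - destruct c as [x y]. apply injective_projections; simpl; ring.
Qed.

Lemma Ceq_Re_Im (a b : C) : Re a = Re b -> Im a = Im b -> a = b.
Proof. apply injective_projections. Qed.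

Lemma is_cseries_unique (a : nat -> C) (l : C) : is_cseries a l -> CSeries a = l.
Proof.
  intros [HR HI]. apply Ceq_Re_Im; simpl; now apply is_series_unique.
Qed.

Lemma is_cseries_ext (a b : nat -> C) (l : C) :
  (forall n, a n = b n) -> is_cseries a l -> is_cseries b l.
Proof.
  intros E [HR HI]; split; [revert HR|revert HI]; apply is_series_ext;
    intros n; now rewrite E.
Qed.

Lemma CSeries_ext (a b : nat -> C) : (forall n, a n = b n) -> CSeries a = CSeries b.
Proof.
  intros E. unfold CSeries. f_equal; apply Series_ext; intros n; now rewrite E.
Qed.

Lemma ex_cabs_Re (a : nat -> C) : ex_cabs a -> ex_series (fun n => Rabs (Re (a n))).
Proof.
  intros H. apply (ex_series_le (V := R_CompleteNormedModule)) with (2 := H).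
  intros n. unfold norm; simpl; unfold abs; simpl. rewrite Rabs_Rabsolu.
  apply re_le_Cmod.
Qed.

Lemma ex_cabs_Im (a : nat -> C) : ex_cabs a -> ex_series (fun n => Rabs (Im (a n))).
Proof.
  intros H. apply (ex_series_le (V := R_CompleteNormedModule)) with (2 := H).
  intros n. unfold norm; simpl; unfold abs; simpl. rewrite Rabs_Rabsolu.
  apply im_le_Cmod.
Qed.

Lemma CSeries_correct (a : nat -> C) : ex_cabs a -> is_cseries a (CSeries a).
Proof.
  intros H. split; apply Series_correct, ex_series_Rabs.
  - now apply ex_cabs_Re.
  - now apply ex_cabs_Im.
Qed.

Lemma is_cseries_scal (c : C) (a : nat -> C) (l : C) :
  is_cseries a l -> is_cseries (fun n => c * a n)%C (c * l)%C.
Proof.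
  intros [HR HI]. split.
  - rewrite re_mult.
    apply (is_series_ext (fun n => minus (scal (Re c) (Re (a n))) (scal (Im c) (Im (a n))))).
    { intros n. now rewrite re_mult. }
    apply (is_series_minus (V := R_NormedModule));
      now apply (is_series_scal_l (V := R_NormedModule)).
  - rewrite im_mult.
    apply (is_series_ext (fun n => plus (scal (Re c) (Im (a n))) (scal (Im c) (Re (a n))))).
    { intros n. now rewrite im_mult. }
    apply (is_series_plus (V := R_NormedModule));
      now apply (is_series_scal_l (V := R_NormedModule)).
Qed.

Lemma is_cseries_plus (a b : nat -> C) (la lb : C) :
  is_cseries a la -> is_cseries b lb ->
  is_cseries (fun n => a n + b n)%C (la + lb)%C.
Proof.
  intros [HR HI] [KR KI].
  split; now apply (is_series_plus (V := R_NormedModule)).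
Qed.

Lemma Re_CSeries_le (a : nat -> C) (m : nat -> R) :
  (forall n, Cmod (a n) <= m n) -> ex_series m ->
  Re (CSeries a) <= Series m.
Proof.
  intros Ha Hm. simpl.
  assert (Hc : ex_cabs a).
  { apply (ex_series_le (V := R_CompleteNormedModule)) with (2 := Hm).
    intros n. unfold norm; simpl; unfold abs; simpl.
    rewrite Rabs_pos_eq by apply Cmod_ge_0. apply Ha. }
  apply Rle_trans with (Series (fun n => Cmod (a n))).
  - apply Rle_trans with (Series (fun n => Rabs (Re (a n)))).
    + eapply Rle_trans; [apply Rle_abs|]. apply Series_Rabs. now apply ex_cabs_Re.
    + apply Series_le; [|exact Hc]. intros n; split; [apply Rabs_pos|apply re_le_Cmod].
  - apply Series_le; [|exact Hm]. intros n; split; [apply Cmod_ge_0|apply Ha].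
Qed.

(** The factor 2, from bounding the two components separately, is harmless in the
    error estimate for which this is used. *)
Lemma Cmod_CSeries_le (a : nat -> C) (m : nat -> R) :
  (forall n, Cmod (a n) <= m n) -> ex_series m ->
  Cmod (CSeries a) <= 2 * Series m.
Proof.
  intros Ha Hm.
  assert (Hc : ex_cabs a).
  { apply (ex_series_le (V := R_CompleteNormedModule)) with (2 := Hm).
    intros n. unfold norm; simpl; unfold abs; simpl.
    rewrite Rabs_pos_eq by apply Cmod_ge_0. apply Ha. }
  eapply Rle_trans; [apply Cmod_le_Re_Im|]. simpl.
  assert (HR : Rabs (Series (fun n => Re (a n))) <= Series m).
  { eapply Rle_trans; [apply Series_Rabs; now apply ex_cabs_Re|].
    apply Series_le; [|exact Hm]. intros n; split; [apply Rabs_pos|].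
    eapply Rle_trans; [apply re_le_Cmod|apply Ha]. }
  assert (HI : Rabs (Series (fun n => Im (a n))) <= Series m).
  { eapply Rle_trans; [apply Series_Rabs; now apply ex_cabs_Im|].
    apply Series_le; [|exact Hm]. intros n; split; [apply Rabs_pos|].
    eapply Rle_trans; [apply im_le_Cmod|apply Ha]. }
  lra.
Qed.

Definition cauchy_coeff (a b : nat -> R) (n : nat) : R :=
  sum_f_R0 (fun k => a k * b (n - k)%nat) n.

Definition cpow_series (a : nat -> R) (z : C) : C :=
  CSeries (fun n => RtoC (a n) * z ^ n)%C.

(** Splitting z^n = z^k z^(n-k) into real and imaginary parts reduces the Cauchy
    product of the complex series to four real ones. *)
Lemma cpow_series_mult (a b : nat -> R) (z : C) :
  ex_series (fun n => Rabs (a n) * Cmod z ^ n) ->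
  ex_series (fun n => Rabs (b n) * Cmod z ^ n) ->
  is_cseries (fun n => RtoC (cauchy_coeff a b n) * z ^ n)%C
             (cpow_series a z * cpow_series b z)%C.
Proof.
  intros Ha Hb.
  assert (Ca : forall a, ex_series (fun n => Rabs (a n) * Cmod z ^ n) ->
               ex_cabs (fun n => RtoC (a n) * z ^ n)%C).
  { clear. intros a H. revert H. apply ex_series_ext. intros n.
    now rewrite Cmod_mult, Cmod_R, Cmod_pow. }
  apply Ca in Ha. apply Ca in Hb.
  assert (Ra := ex_cabs_Re _ Ha). assert (Ia := ex_cabs_Im _ Ha).
  assert (Rb := ex_cabs_Re _ Hb). assert (Ib := ex_cabs_Im _ Hb).
  destruct (CSeries_correct _ Ha) as [SRa SIa].
  destruct (CSeries_correct _ Hb) as [SRb SIb].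
  fold (cpow_series a z) in SRa, SIa. fold (cpow_series b z) in SRb, SIb.
  split.
  - rewrite re_mult.
    generalize (is_series_minus (V := R_NormedModule) _ _ _ _
      (is_series_mult _ _ _ _ SRa SRb Ra Rb) (is_series_mult _ _ _ _ SIa SIb Ia Ib)).
    apply is_series_ext. intros n.
    rewrite re_scal_l. unfold cauchy_coeff. rewrite (Rmult_comm (sum_f_R0 _ _)), scal_sum.
    change (sum_f_R0 (fun k => Re (RtoC (a k) * z ^ k) * Re (RtoC (b (n - k)%nat) * z ^ (n - k))) n
      - sum_f_R0 (fun k => Im (RtoC (a k) * z ^ k) * Im (RtoC (b (n - k)%nat) * z ^ (n - k))) n
      = sum_f_R0 (fun k => a k * b (n - k)%nat * Re (z ^ n)) n).
    rewrite <- minus_sum. apply sum_eq. intros k Hk.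
    replace (z ^ n)%C with (z ^ k * z ^ (n - k))%C
      by (rewrite <- Cpow_add_r; f_equal; lia).
    rewrite !re_scal_l, !im_scal_l, re_mult. ring.
  - rewrite im_mult.
    generalize (is_series_plus (V := R_NormedModule) _ _ _ _
      (is_series_mult _ _ _ _ SRa SIb Ra Ib) (is_series_mult _ _ _ _ SIa SRb Ia Rb)).
    apply is_series_ext. intros n.
    rewrite im_scal_l. unfold cauchy_coeff. rewrite (Rmult_comm (sum_f_R0 _ _)), scal_sum.
    change (sum_f_R0 (fun k => Re (RtoC (a k) * z ^ k) * Im (RtoC (b (n - k)%nat) * z ^ (n - k))) n
      + sum_f_R0 (fun k => Im (RtoC (a k) * z ^ k) * Re (RtoC (b (n - k)%nat) * z ^ (n - k))) n
      = sum_f_R0 (fun k => a k * b (n - k)%nat * Im (z ^ n)) n).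
    rewrite <- plus_sum. apply sum_eq. intros k Hk.
    replace (z ^ n)%C with (z ^ k * z ^ (n - k))%C
      by (rewrite <- Cpow_add_r; f_equal; lia).
    rewrite !re_scal_l, !im_scal_l, im_mult. ring.
Qed.

(** A first order expansion whose error is quadratic on the unit ball suffices for
    differentiability, and is easier to verify for a sum of powers than the general
    little-o condition. *)
Lemma is_derive_of_quadratic (f : C -> C) (z l : C) (M : R) :
  (forall h, Cmod h <= 1 -> Cmod (f (z + h) - f z - h * l)%C <= M * Cmod h ^ 2) ->
  is_derive f z l.
Proof.
  intros H. split.
  - apply is_linear_scal_l.
  - intros x Hx.
    assert (E : z = x).
    { apply (is_filter_lim_locally_unique (K := C_AbsRing)
                (V := AbsRing_NormedModule C_AbsRing)). exact Hx. }
    subst x. intros eps.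
    (* Taking h = 1 shows that the constant is nonnegative. *)
    assert (HM : 0 <= M).
    { generalize (H 1%C ltac:(rewrite Cmod_1; lra)). rewrite Cmod_1.
      generalize (Cmod_ge_0 (f (z + 1) - f z - 1 * l)%C). intros. nra. }
    assert (Hd : 0 < Rmin 1 (eps / (M + 1))).
    { apply Rmin_pos; [lra|]. apply Rdiv_lt_0_compat; [apply cond_pos|lra]. }
    exists (mkposreal _ Hd). intros y Hy.
    change (Cmod (y - z)%C < Rmin 1 (eps / (M + 1))) in Hy.
    change (Cmod (f y - f z - (y - z) * l)%C <= eps * Cmod (y - z)%C).
    set (h := (y - z)%C) in *.
    replace y with (z + h)%C by (unfold h; ring).
    assert (Hy1 : Cmod h <= 1).
    { apply Rlt_le, (Rlt_le_trans _ _ _ Hy), Rmin_l. }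
    assert (Hy2 : Cmod h <= eps / (M + 1)).
    { apply Rlt_le, (Rlt_le_trans _ _ _ Hy), Rmin_r. }
    eapply Rle_trans; [apply H; exact Hy1|].
    assert (Hh := Cmod_ge_0 h).
    assert ((M + 1) * Cmod h <= eps).
    { apply (Rmult_le_compat_l (M + 1)) in Hy2; [|lra].
      replace ((M + 1) * (eps / (M + 1))) with (pos eps) in Hy2 by (field; lra). lra. }
    simpl. nra.
Qed.

(** By induction on n: the error E_n satisfies
    E_(n+1) = (z + h) E_n + n z^(n-1) h^2, and |z + h| <= |z| + 1. The bound is geometric
    in n, so that the errors of an entire series can be summed. *)
Lemma Cpow_taylor1 (z h : C) (n : nat) :
  Cmod h <= 1 ->
  Cmod ((z + h) ^ n - z ^ n - h * (RtoC (INR n) * z ^ pred n))%C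
    <= (2 * (Cmod z + 1)) ^ n * Cmod h ^ 2.
Proof.
  intros Hh. set (rho := Cmod z + 1).
  assert (Hz := Cmod_ge_0 z). assert (Hh0 := Cmod_ge_0 h).
  assert (Hrho : 1 <= rho) by (unfold rho; lra).
  assert (Hn : forall n, INR n * Cmod z ^ pred n <= (2 * rho) ^ n).
  { intros m. rewrite Rpow_mult_distr.
    assert (A : INR m <= 2 ^ m).
    { clear. induction m; [simpl; lra|]. rewrite S_INR. simpl.
      assert (1 <= 2 ^ m) by (apply pow_R1_Rle; lra). lra. }
    assert (B : Cmod z ^ pred m <= rho ^ m).
    { apply Rle_trans with (rho ^ pred m).
      - apply pow_incr. unfold rho; lra.
      - apply Rle_pow; [lra|lia]. }
    apply Rmult_le_compat; auto.
    - apply pos_INR.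
    - now apply pow_le. }
  induction n as [|n IH].
  - simpl. replace (1 - 1 - h * (0 * 1))%C with (RtoC 0) by ring.
    rewrite Cmod_0. nra.
  - replace ((z + h) ^ S n - z ^ S n - h * (RtoC (INR (S n)) * z ^ pred (S n)))%C
      with ((z + h) * ((z + h) ^ n - z ^ n - h * (RtoC (INR n) * z ^ pred n))
            + h * h * (RtoC (INR n) * z ^ pred n))%C.
    + eapply Rle_trans; [apply Cmod_triangle|].
      rewrite !Cmod_mult, Cmod_R, Cmod_pow, (Rabs_pos_eq (INR n)) by apply pos_INR.
      assert (Hzh : Cmod (z + h)%C <= rho).
      { eapply Rle_trans; [apply Cmod_triangle|]. unfold rho; lra. }
      assert (A : Cmod (z + h)%C *
        Cmod ((z + h) ^ n - z ^ n - h * (RtoC (INR n) * z ^ pred n))%C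
        <= rho * ((2 * rho) ^ n * Cmod h ^ 2)).
      { apply Rmult_le_compat; auto; apply Cmod_ge_0. }
      specialize (Hn n).
      assert (P : 0 <= (2 * rho) ^ n) by (apply pow_le; lra).
      assert (B : Cmod h * Cmod h * (INR n * Cmod z ^ pred n)
                  <= Cmod h ^ 2 * (2 * rho) ^ n).
      { simpl. rewrite Rmult_1_r. apply Rmult_le_compat_l; auto.
        now apply Rmult_le_pos. }
      assert (Q : 0 <= (2 * rho) ^ n * Cmod h ^ 2).
      { apply Rmult_le_pos; auto. apply pow_le; auto. }
      assert (rho * ((2 * rho) ^ n * Cmod h ^ 2) >= 1 * ((2 * rho) ^ n * Cmod h ^ 2)).
      { apply Rle_ge, Rmult_le_compat_r; auto. }
      replace ((2 * rho) ^ S n * Cmod h ^ 2)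
        with (2 * (rho * ((2 * rho) ^ n * Cmod h ^ 2))) by (simpl; ring).
      lra.
    + destruct n as [|m].
      * simpl. ring.
      * rewrite (S_INR (S m)), RtoC_plus. simpl pred. rewrite !Cpow_S. ring.
Qed.

Lemma ex_cabs_derive (a : nat -> R) (e : nat -> nat) (z : C) :
  (forall r, 0 <= r -> ex_series (fun n => Rabs (a n) * r ^ e n)) ->
  ex_cabs (fun n => RtoC (a n * INR (e n)) * z ^ pred (e n))%C.
Proof.
  intros Ha. assert (Hz := Cmod_ge_0 z).
  apply (ex_series_le (V := R_CompleteNormedModule)) with (2 := Ha (2 * (Cmod z + 1)) ltac:(lra)).
  intros n. unfold norm; simpl; unfold abs; simpl.
  rewrite Rabs_pos_eq by apply Cmod_ge_0.
  rewrite Cmod_mult, Cmod_R, Cmod_pow, Rabs_mult, Rmult_assoc.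
  apply Rmult_le_compat_l; [apply Rabs_pos|].
  rewrite (Rabs_pos_eq (INR _)) by apply pos_INR.
  rewrite Rpow_mult_distr. apply Rmult_le_compat.
  - apply pos_INR.
  - now apply pow_le.
  - generalize (e n). clear. induction n; [simpl; lra|]. rewrite S_INR. simpl.
    assert (1 <= 2 ^ n) by (apply pow_R1_Rle; lra). lra.
  - apply Rle_trans with ((Cmod z + 1) ^ pred (e n)).
    + apply pow_incr. lra.
    + apply Rle_pow; [lra|lia].
Qed.

(** The exponents e(n) are arbitrary so that the series in z^(4n+1) and z^(4n) can be
    differentiated without the chain rule. *)
Lemma is_derive_cseries (a : nat -> R) (e : nat -> nat) (z : C) :
  (forall r, 0 <= r -> ex_series (fun n => Rabs (a n) * r ^ e n)) ->
  is_derive (fun z => CSeries (fun n => RtoC (a n) * z ^ e n)%C) z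
            (CSeries (fun n => RtoC (a n * INR (e n)) * z ^ pred (e n))%C).
Proof.
  intros Ha.
  assert (Hz := Cmod_ge_0 z).
  set (r := 2 * (Cmod z + 1)).
  assert (Habs : forall y, ex_cabs (fun n => RtoC (a n) * y ^ e n)%C).
  { intros y. generalize (Ha (Cmod y) (Cmod_ge_0 y)). apply ex_series_ext.
    intros n. now rewrite Cmod_mult, Cmod_R, Cmod_pow. }
  assert (Hda := ex_cabs_derive a e z Ha).
  (* The remainder is the series of the errors of the single powers. *)
  apply is_derive_of_quadratic with (2 * Series (fun n => Rabs (a n) * r ^ e n)).
  intros h Hh.
  set (E := fun n => (RtoC (a n) *
     ((z + h) ^ e n - z ^ e n - h * (RtoC (INR (e n)) * z ^ pred (e n))))%C).
  assert (HE : is_cseries E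
     (CSeries (fun n => RtoC (a n) * (z + h) ^ e n)%C
      + (RtoC (-1) * CSeries (fun n => RtoC (a n) * z ^ e n)%C
      + - h * CSeries (fun n => RtoC (a n * INR (e n)) * z ^ pred (e n))%C))%C).
  { eapply is_cseries_ext.
    2: { apply is_cseries_plus; [apply CSeries_correct, Habs|].
         apply is_cseries_plus; apply is_cseries_scal, CSeries_correct;
           [apply Habs|apply Hda]. }
    intros n. unfold E. simpl. rewrite RtoC_mult. ring. }
  replace (CSeries (fun n => RtoC (a n) * (z + h) ^ e n)%C
           - CSeries (fun n => RtoC (a n) * z ^ e n)%C
           - h * CSeries (fun n => RtoC (a n * INR (e n)) * z ^ pred (e n))%C)%C
    with (CSeries E) by (rewrite (is_cseries_unique _ _ HE); ring).
  replace (2 * Series (fun n => Rabs (a n) * r ^ e n) * Cmod h ^ 2)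
    with (2 * Series (fun n => Cmod h ^ 2 * (Rabs (a n) * r ^ e n)))
    by (rewrite Series_scal_l; ring).
  apply Cmod_CSeries_le.
  - intros n. unfold E. rewrite Cmod_mult, Cmod_R.
    replace (Cmod h ^ 2 * (Rabs (a n) * r ^ e n))
      with (Rabs (a n) * (r ^ e n * Cmod h ^ 2)) by ring.
    apply Rmult_le_compat_l; [apply Rabs_pos|]. now apply Cpow_taylor1.
  - apply (ex_series_scal_l (V := R_NormedModule)). apply Ha. unfold r; lra.
Qed.

(** * A terminating case of Kummer's summation theorem *)

Lemma pochhammer_pos (a : R) (n : nat) : 0 < a -> 0 < pochhammer a n.
Proof.
  intros Ha. induction n as [|n IH]; simpl; [lra|].
  apply Rmult_lt_0_compat; [exact IH|]. generalize (pos_INR n); lra.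
Qed.

Lemma pochhammer_S_l (a : R) (n : nat) :
  pochhammer a (S n) = a * pochhammer (a + 1) n.
Proof.
  induction n as [|n IH]; [simpl; ring|].
  change (pochhammer a (S n) * (a + INR (S n)) = a * (pochhammer (a + 1) n * (a + 1 + INR n))).
  rewrite IH, S_INR. ring.
Qed.

Lemma pochhammer_shift (a : R) (n : nat) :
  pochhammer a n * (a + INR n) = a * pochhammer (a + 1) n.
Proof. now rewrite <- pochhammer_S_l. Qed.

Lemma Gamma_pochhammer (a : R) (n : nat) :
  0 < a -> Gamma (a + INR n) = pochhammer a n * Gamma a.
Proof.
  intros Ha. induction n as [|n IH].
  - simpl. rewrite Rplus_0_r. ring.
  - rewrite S_INR. replace (a + (INR n + 1)) with ((a + INR n) + 1) by ring.
    rewrite Gamma_S, IH; [simpl; ring|]. generalize (pos_INR n); lra.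
Qed.

Definition kummer_term (n : nat) (a b : R) (k : nat) : R :=
  (-1) ^ k / (INR (fact k) * INR (fact (n - k)) * pochhammer a k * pochhammer b (n - k)).

(** The coefficient of x^n in F_a(-x) F_b(x), where F_a(x) = sum x^n / (n! (a)_n);
    the case a = b gives, up to a factor, the product of the two Bessel series. *)
Definition kummer_sum (n : nat) (a b : R) : R := sum_f_R0 (kummer_term n a b) n.

Lemma kummer_term_l (n k : nat) (a b : R) :
  0 < a -> 0 < b ->
  INR (S k) * kummer_term (S n) a b (S k) = - kummer_term n (a + 1) b k / a.
Proof.
  intros Ha Hb. unfold kummer_term. rewrite pochhammer_S_l.
  replace (S n - S k)%nat with (n - k)%nat by lia.
  rewrite fact_simpl, mult_INR.
  assert (H1 := INR_fact_neq_0 k). assert (H2 := INR_fact_neq_0 (n - k)).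
  assert (H3 := not_0_INR (S k) ltac:(lia)).
  assert (H4 := pochhammer_pos (a + 1) k ltac:(lra)).
  assert (H5 := pochhammer_pos b (n - k) ltac:(lra)).
  simpl pow. field. repeat split; lra.
Qed.

Lemma kummer_term_r (n k : nat) (a b : R) :
  0 < a -> 0 < b -> (k <= n)%nat ->
  INR (S n - k) * kummer_term (S n) a b k = kummer_term n a (b + 1) k / b.
Proof.
  intros Ha Hb Hk. unfold kummer_term.
  replace (S n - k)%nat with (S (n - k)) by lia.
  rewrite pochhammer_S_l, fact_simpl, mult_INR.
  assert (H1 := INR_fact_neq_0 k). assert (H2 := INR_fact_neq_0 (n - k)).
  assert (H3 := not_0_INR (S (n - k)) ltac:(lia)).
  assert (H4 := pochhammer_pos a k ltac:(lra)).
  assert (H5 := pochhammer_pos (b + 1) (n - k) ltac:(lra)).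
  field. repeat split; lra.
Qed.

(** The derivative of F_a(-x) F_b(x), as F_a' = F_(a+1) / a. *)
Lemma kummer_sum_derive (n : nat) (a b : R) :
  0 < a -> 0 < b ->
  INR (S n) * kummer_sum (S n) a b
  = kummer_sum n a (b + 1) / b - kummer_sum n (a + 1) b / a.
Proof.
  intros Ha Hb. unfold kummer_sum at 1. rewrite scal_sum.
  rewrite (sum_eq _ (fun k => INR (S n - k) * kummer_term (S n) a b k
                              + INR k * kummer_term (S n) a b k)).
  2: { intros k Hk. rewrite minus_INR by exact Hk. ring. }
  rewrite plus_sum. rewrite tech5, Nat.sub_diag.
  rewrite (decomp_sum (fun k => INR k * kummer_term (S n) a b k)) by lia.
  simpl (INR 0). rewrite !Rmult_0_l, Rplus_0_r, Rplus_0_l.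
  rewrite (sum_eq _ (fun k => kummer_term n a (b + 1) k * / b)).
  2: { intros k Hk. now apply kummer_term_r. }
  simpl pred.
  rewrite (sum_eq (fun i => INR (S i) * kummer_term (S n) a b (S i))
             (fun k => kummer_term n (a + 1) b k * (- / a))).
  2: { intros k Hk. rewrite kummer_term_l by assumption. field. lra. }
  rewrite <- !scal_sum. unfold kummer_sum. field. lra.
Qed.

(** The contiguous relation F_a(x) = F_(a+1)(x) + x F_(a+2)(x) / (a (a+1)). *)
Lemma kummer_sum_contiguous (n : nat) (a b : R) :
  0 < a -> 0 < b ->
  kummer_sum (S n) a b
  = kummer_sum (S n) (a + 1) b - kummer_sum n (a + 2) b / (a * (a + 1)).
Proof.
  intros Ha Hb.
  assert (E : forall k, kummer_term (S n) a b k
    = kummer_term (S n) (a + 1) b k + INR k * kummer_term (S n) (a + 1) b k * / a).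
  { intros k. unfold kummer_term.
    assert (H1 := INR_fact_neq_0 k). assert (H2 := INR_fact_neq_0 (S n - k)).
    assert (H4 := pochhammer_pos (a + 1) k ltac:(lra)).
    assert (H5 := pochhammer_pos b (S n - k) ltac:(lra)).
    assert (H6 := pochhammer_pos a k ltac:(lra)).
    assert (H7 := pochhammer_shift a k). assert (H8 := pos_INR k).
    replace (pochhammer (a + 1) k) with (pochhammer a k * (a + INR k) / a).
    - field. repeat split; lra.
    - rewrite H7. field. lra. }
  unfold kummer_sum at 1. rewrite (sum_eq _ _ _ (fun k _ => E k)), plus_sum.
  fold (kummer_sum (S n) (a + 1) b).
  rewrite (decomp_sum (fun k => INR k * kummer_term (S n) (a + 1) b k * / a)) by lia.
  simpl (INR 0). simpl pred.
  rewrite (sum_eq _ (fun k => kummer_term n (a + 2) b k * (- / (a * (a + 1))))).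
  2: { intros k Hk. rewrite kummer_term_l by lra. replace (a + 1 + 1) with (a + 2) by ring.
       field. lra. }
  rewrite <- scal_sum. unfold kummer_sum. field. lra.
Qed.

Lemma sum_f_R0_rev (f : nat -> R) (n : nat) :
  sum_f_R0 (fun k => f (n - k)%nat) n = sum_f_R0 f n.
Proof.
  induction n as [|n IH]; [reflexivity|].
  rewrite decomp_sum by lia. simpl pred. rewrite Nat.sub_0_r.
  rewrite (tech5 f), <- IH. rewrite Rplus_comm. f_equal.
Qed.

Lemma pow_m1_sub (n k : nat) : (k <= n)%nat -> (-1) ^ (n - k) = (-1) ^ n * (-1) ^ k.
Proof.
  intros Hk. replace n with ((n - k) + k)%nat at 2 by lia.
  rewrite pow_add, Rmult_assoc, <- Rpow_mult_distr.
  replace (-1 * -1) with 1 by ring. rewrite pow1. ring.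
Qed.

Lemma kummer_sum_swap (n : nat) (a b : R) :
  kummer_sum n b a = (-1) ^ n * kummer_sum n a b.
Proof.
  unfold kummer_sum. rewrite scal_sum, <- sum_f_R0_rev. apply sum_eq. intros k Hk.
  unfold kummer_term. replace (n - (n - k))%nat with k by lia.
  rewrite pow_m1_sub by exact Hk. unfold Rdiv.
  replace (INR (fact (n - k)) * INR (fact k) * pochhammer b (n - k) * pochhammer a k)
    with (INR (fact k) * INR (fact (n - k)) * pochhammer a k * pochhammer b (n - k)) by ring.
  ring.
Qed.

Lemma pow_m1_even (m : nat) : (-1) ^ (2 * m) = 1.
Proof. rewrite pow_mult. replace ((-1) ^ 2) with 1 by ring. apply pow1. Qed.

Lemma pow_m1_odd (m : nat) : (-1) ^ S (2 * m) = -1.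
Proof. rewrite <- tech_pow_Rmult, pow_m1_even. ring. Qed.

Lemma kummer_sum_S (n : nat) (a : R) :
  0 < a ->
  INR (S n) * kummer_sum (S n) a a = (1 - (-1) ^ n) * kummer_sum n a (a + 1) / a.
Proof.
  intros Ha. rewrite kummer_sum_derive, (kummer_sum_swap n a (a + 1)) by assumption.
  field. lra.
Qed.

Lemma kummer_sum_odd (m : nat) (a : R) : 0 < a -> kummer_sum (S (2 * m)) a a = 0.
Proof.
  intros Ha. assert (H := kummer_sum_S (2 * m) a Ha). rewrite pow_m1_even in H.
  apply (Rmult_eq_reg_l (INR (S (2 * m)))).
  - rewrite H. field. lra.
  - apply not_0_INR. lia.
Qed.

(** For m > 0 the contiguous relation lowers the degree by one, and
    [kummer_sum_S] read backwards returns to an even sum with equal parameters. *)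
Lemma kummer_sum_even_contiguous (m : nat) (a : R) :
  0 < a -> kummer_sum (2 * m) a (a + 1) = kummer_sum (2 * m) (a + 1) (a + 1) * (1 + INR m / a).
Proof.
  intros Ha. destruct m as [|m].
  - unfold kummer_sum, kummer_term; simpl. field. lra.
  - replace (2 * S m)%nat with (S (S (2 * m))) by lia.
    rewrite kummer_sum_contiguous by lra.
    replace (a + 2) with (a + 1 + 1) by ring.
    rewrite (kummer_sum_swap (S (2 * m)) (a + 1) (a + 1 + 1)).
    assert (H := kummer_sum_S (S (2 * m)) (a + 1) ltac:(lra)).
    rewrite pow_m1_odd in *.
    replace (kummer_sum (S (2 * m)) (a + 1) (a + 1 + 1))
      with (INR (S (S (2 * m))) * (a + 1) / 2 * kummer_sum (S (S (2 * m))) (a + 1) (a + 1)).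
    + rewrite !S_INR, mult_INR. simpl (INR 2). field. lra.
    + apply (Rmult_eq_reg_l (2 / (a + 1))).
      * transitivity ((1 - -1) * kummer_sum (S (2 * m)) (a + 1) (a + 1 + 1) / (a + 1)).
        -- rewrite <- H. field. lra.
        -- field. lra.
      * apply Rgt_not_eq, Rdiv_lt_0_compat; lra.
Qed.

(** The sums with parameters (a, a) and (a, a+1) determine each other; alternating
    between them twice raises a by 2 and the degree by 2. *)
Lemma kummer_sum_even_S (m : nat) (a : R) :
  0 < a ->
  kummer_sum (2 * S m) a a
  = - (a + 1 + INR m) / (INR (S m) * a ^ 2 * (a + 1) ^ 2) * kummer_sum (2 * m) (a + 2) (a + 2).
Proof.
  intros Ha. replace (2 * S m)%nat with (S (S (2 * m))) by lia.
  assert (H := kummer_sum_S (S (2 * m)) a Ha).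
  rewrite (kummer_sum_contiguous (2 * m) a (a + 1)) in H by lra.
  rewrite kummer_sum_odd in H by lra.
  replace (a + 2) with (a + 1 + 1) in * by ring.
  rewrite (kummer_sum_swap (2 * m) (a + 1) (a + 1 + 1)) in H.
  rewrite kummer_sum_even_contiguous in H by lra.
  rewrite pow_m1_odd, pow_m1_even in H.
  assert (Hm := pos_INR m).
  apply (Rmult_eq_reg_l (INR (S (S (2 * m))))).
  - rewrite H. rewrite !S_INR, mult_INR. simpl (INR 2). field. repeat split; lra.
  - apply not_0_INR. lia.
Qed.

Lemma kummer_sum_even (m : nat) (a : R) :
  0 < a ->
  kummer_sum (2 * m) a a
  = (-1) ^ m / (INR (fact m) * pochhammer a m * pochhammer a (2 * m)).
Proof.
  revert a. induction m as [|m IH]; intros a Ha.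
  - unfold kummer_sum, kummer_term; simpl. field.
  - rewrite kummer_sum_even_S, IH by lra.
    replace (2 * S m)%nat with (S (S (2 * m))) by lia.
    rewrite !pochhammer_S_l, fact_simpl, mult_INR.
    assert (H1 := INR_fact_neq_0 m). assert (Hm := pos_INR m).
    assert (H3 := not_0_INR (S m) ltac:(lia)).
    assert (H7 := pochhammer_shift (a + 1) m).
    replace (a + 1 + 1) with (a + 2) in * by ring.
    assert (H4 := pochhammer_pos (a + 2) m ltac:(lra)).
    assert (H5 := pochhammer_pos (a + 2) (2 * m) ltac:(lra)).
    assert (H6 := pochhammer_pos (a + 1) m ltac:(lra)).
    replace (pochhammer (a + 2) m) with (pochhammer (a + 1) m * (a + 1 + INR m) / (a + 1)).
    + simpl pow. field. repeat split; lra.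
    + rewrite H7. field. lra.
Qed.

(** * The power series of v *)

(** The hypothesis gives d_n <= d_0 K^n / n!, so the exponential series
    dominates. *)
Lemma ex_series_factorial_decay (d : nat -> R) (K r : R) :
  0 <= K -> 0 <= r -> (forall n, 0 <= d n) ->
  (forall n, d (S n) <= K / INR (S n) * d n) ->
  ex_series (fun n => d n * r ^ n).
Proof.
  intros HK Hr Hd Hrat.
  assert (Hb : forall n, d n <= d 0%nat * (K ^ n / INR (fact n))).
  { induction n as [|n IH]; [simpl; lra|].
    eapply Rle_trans; [apply Hrat|].
    assert (Hn := lt_0_INR (S n) ltac:(lia)).
    assert (H1 := INR_fact_neq_0 n).
    apply Rle_trans with (K / INR (S n) * (d 0%nat * (K ^ n / INR (fact n)))).
    - apply Rmult_le_compat_l; [|exact IH]. apply Rmult_le_pos; [lra|].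
      apply Rlt_le, Rinv_0_lt_compat, Hn.
    - right. rewrite fact_simpl, mult_INR. simpl pow. field. lra. }
  apply (ex_series_le (V := R_CompleteNormedModule))
    with (fun n => d 0%nat * ((K * r) ^ n * / INR (fact n))).
  - intros n. unfold norm; simpl; unfold abs; simpl.
    assert (Hrn : 0 <= r ^ n) by now apply pow_le.
    rewrite Rabs_pos_eq by now apply Rmult_le_pos.
    rewrite Rpow_mult_distr.
    replace (d 0%nat * (K ^ n * r ^ n * / INR (fact n)))
      with (d 0%nat * (K ^ n / INR (fact n)) * r ^ n) by (unfold Rdiv; ring).
    now apply Rmult_le_compat_r.
  - apply (ex_series_scal_l (V := R_NormedModule)). exists (exp (K * r)).
    generalize (is_exp_Reals (K * r)). apply is_series_ext. intros n.
    rewrite pow_n_pow. reflexivity.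
Qed.

Lemma sum_n_even (f : nat -> R) (N : nat) :
  (forall m, f (S (2 * m)) = 0) ->
  sum_n f (2 * N) = sum_n (fun m => f (2 * m)%nat) N.
Proof.
  intros Hf. induction N as [|N IH].
  - now rewrite !sum_O.
  - replace (2 * S N)%nat with (S (S (2 * N))) by lia.
    rewrite !sum_Sn, IH, Hf. replace (2 * S N)%nat with (S (S (2 * N))) by lia.
    unfold plus; simpl. ring.
Qed.

Lemma is_series_even (f : nat -> R) (l : R) :
  (forall m, f (S (2 * m)) = 0) ->
  is_series f l -> is_series (fun m => f (2 * m)%nat) l.
Proof.
  intros Hf Hl.
  change (is_lim_seq (sum_n (fun m => f (2 * m)%nat)) l).
  apply (is_lim_seq_ext (fun N => sum_n f (2 * N))).
  { intros N. now apply sum_n_even. }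
  apply (is_lim_seq_subseq (sum_n f) l (fun N => (2 * N)%nat)); [|exact Hl].
  apply eventually_subseq. intros n. lia.
Qed.

Lemma is_cseries_even (f : nat -> C) (l : C) :
  (forall m, f (S (2 * m)) = 0%C) ->
  is_cseries f l -> is_cseries (fun m => f (2 * m)%nat) l.
Proof.
  intros Hf [HR HI]. split.
  - apply (is_series_even (fun n => Re (f n))); auto. intros m; now rewrite Hf.
  - apply (is_series_even (fun n => Im (f n))); auto. intros m; now rewrite Hf.
Qed.

Lemma Cexp_plus (x y : C) : Cexp (x + y) = (Cexp x * Cexp y)%C.
Proof.
  unfold Cexp. rewrite re_plus, im_plus, exp_plus, cos_plus, sin_plus.
  apply injective_projections; simpl; ring.
Qed.

Lemma Cexp_RtoC (x : R) : Cexp (RtoC x) = RtoC (exp x).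
Proof.
  unfold Cexp; simpl. rewrite cos_0, sin_0.
  apply injective_projections; simpl; ring.
Qed.

(** The principal argument enters only through this identity and its invariance under
    halving: the branch cut of the logarithm does not matter once the powers are
    multiplied together. *)
Lemma Cexp_Clog (z : C) : z <> 0 -> Cexp (Clog z) = z.
Proof.
  intros Hz. assert (Hm : 0 < Cmod z) by now apply Cmod_gt_0.
  assert (Hre := re_le_Cmod z). apply Rabs_le_between in Hre.
  set (q := Re z / Cmod z).
  assert (Hq : -1 <= q <= 1).
  { unfold q. split.
    - apply Rmult_le_reg_r with (Cmod z); auto. field_simplify; lra.
    - apply Rmult_le_reg_r with (Cmod z); auto. field_simplify; lra. }
  assert (HIm : sqrt (1 - q²) * Cmod z = Rabs (Im z)).
  { rewrite <- (sqrt_Rsqr (Cmod z)) by lra.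
    rewrite <- sqrt_mult_alt.
    2: { unfold Rsqr. nra. }
    rewrite <- sqrt_Rsqr_abs. f_equal.
    assert (E := Cmod2_alt z). unfold q, Rsqr. field_simplify; [|lra].
    simpl in E. simpl. rewrite !Rmult_1_r in *. lra. }
  unfold Cexp, Clog, Carg; simpl. rewrite exp_ln by assumption. fold q.
  apply injective_projections; simpl.
  - destruct (Rle_dec 0 (Im z)); rewrite ?cos_neg, cos_acos by exact Hq;
      unfold q; field_simplify; try reflexivity; lra.
  - destruct (Rle_dec 0 (Im z)) as [H|H]; rewrite ?sin_neg, sin_acos by exact Hq.
    + rewrite Rmult_comm, HIm. now apply Rabs_pos_eq.
    + rewrite Ropp_mult_distr_r_reverse, Rmult_comm, HIm.
      rewrite Rabs_left by lra. unfold Im. ring.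
Qed.

Lemma Clog_half (z : C) : z <> 0 -> Clog (z / 2) = (Clog z - RtoC (ln 2))%C.
Proof.
  intros Hz. assert (Hm : 0 < Cmod z) by now apply Cmod_gt_0.
  assert (H2 : Cmod (z / 2) = Cmod z / 2).
  { rewrite Cmod_div, Cmod_R, Rabs_pos_eq; auto; try lra.
    intros E. injection E. lra. }
  assert (E : (z / 2)%C = (Re z / 2, Im z / 2)).
  { destruct z as [x y]. apply injective_projections; simpl; field. }
  unfold Clog, Carg. rewrite H2. rewrite E. simpl Re. simpl Im.
  unfold Rdiv at 1. rewrite ln_mult, ln_Rinv by lra.
  replace (Re z / 2 / (Cmod z / 2)) with (Re z / Cmod z) by (field; lra).
  apply injective_projections; simpl; [ring|].
  destruct (Rle_dec 0 (Im z / 2)), (Rle_dec 0 (Im z)); try lra.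
Qed.

(** The exponents of Clog z add up to (1 - 2 nu) + 2 nu = 1, and the logarithms
    of 2 cancel, so the product is exp (Clog z) = z. *)
Lemma Cpower_cancel (nu : R) (z : C) :
  z <> 0 ->
  (RtoC (Rpower 2 (2 * nu)) * Cpower z (-2 * nu + 1)
   * (Cpower (z / 2) nu * Cpower (z / 2) nu))%C = z.
Proof.
  intros Hz.
  assert (Hz2 : (z / 2)%C <> 0%C).
  { intros E. apply Hz. replace z with (2 * (z / 2))%C by (field; intros H; injection H; lra).
    rewrite E. ring. }
  unfold Cpower. destruct (Ceq_dec z 0) as [|_]; [contradiction|].
  destruct (Ceq_dec (z / 2) 0) as [|_]; [contradiction|].
  rewrite Clog_half by assumption. unfold Rpower. rewrite <- Cexp_RtoC, <- !Cexp_plus.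
  transitivity (Cexp (Clog z)); [f_equal|now apply Cexp_Clog].
  rewrite RtoC_plus, !RtoC_mult. ring.
Qed.

(** The coefficients of v, up to sign: they come with z^(4n+1). *)
Definition v_coeff (a : R) (n : nat) : R :=
  1 / (16 ^ n * INR (fact n) * pochhammer a n * pochhammer a (2 * n)).

(** Cpower vanishes at 0 except with exponent 0, and the exponents nu and
    1 - 2 nu are not both 0. *)
Lemma v_0 (nu : R) : v nu 0 = 0%C.
Proof.
  unfold v, BesselProd, BesselJ, BesselI.
  assert (E : (0 / 2)%C = 0%C).
  { apply injective_projections; simpl; field. }
  rewrite E. unfold Cpower.
  destruct (Ceq_dec 0 0) as [_|N]; [|now contradict N].
  destruct (Req_dec_T nu 0) as [->|].
  - destruct (Req_dec_T (-2 * 0 + 1) 0) as [H|_]; [lra|]. ring.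
  - ring.
Qed.

Definition bessel_coeff (nu : R) (n : nat) : R := 1 / (INR (fact n) * Gamma (nu + INR n + 1)).

Definition alt_bessel_coeff (nu : R) (n : nat) : R := (-1) ^ n * bessel_coeff nu n.

Lemma bessel_coeff_eq (nu : R) (n : nat) :
  -1 < nu ->
  bessel_coeff nu n = 1 / (INR (fact n) * pochhammer (nu + 1) n * Gamma (nu + 1)).
Proof.
  intros Hnu. unfold bessel_coeff. replace (nu + INR n + 1) with (nu + 1 + INR n) by ring.
  rewrite Gamma_pochhammer by lra. f_equal. ring.
Qed.

Lemma ex_series_bessel_coeff (nu r : R) :
  -1 < nu -> 0 <= r -> ex_series (fun n => bessel_coeff nu n * r ^ n).
Proof.
  intros Hnu Hr.
  assert (Hp : forall n, 0 < bessel_coeff nu n).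
  { intros n. rewrite bessel_coeff_eq by assumption. apply Rdiv_lt_0_compat; [lra|].
    repeat apply Rmult_lt_0_compat; [apply INR_fact_lt_0|apply pochhammer_pos; lra|].
    apply Gamma_pos; lra. }
  apply ex_series_factorial_decay with (/ (nu + 1)); auto.
  - apply Rlt_le, Rinv_0_lt_compat; lra.
  - intros n; now apply Rlt_le.
  - intros n.
    assert (E : bessel_coeff nu (S n) = / (nu + 1 + INR n) / INR (S n) * bessel_coeff nu n).
    { rewrite !bessel_coeff_eq by assumption. rewrite fact_simpl, mult_INR.
      change (pochhammer (nu + 1) (S n)) with (pochhammer (nu + 1) n * (nu + 1 + INR n)).
      assert (H1 := INR_fact_neq_0 n). assert (Hn := pos_INR n).
      assert (H3 := not_0_INR (S n) ltac:(lia)).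
      assert (H4 := pochhammer_pos (nu + 1) n ltac:(lra)).
      assert (H5 := Gamma_pos (nu + 1) ltac:(lra)). field. repeat split; lra. }
    rewrite E. apply Rmult_le_compat_r; [now apply Rlt_le|].
    apply Rmult_le_compat_r; [apply Rlt_le, Rinv_0_lt_compat, lt_0_INR; lia|].
    apply Rinv_le_contravar; [lra|]. generalize (pos_INR n); lra.
Qed.

Lemma conv_bessel (nu : R) (n : nat) :
  -1 < nu ->
  cauchy_coeff (alt_bessel_coeff nu) (bessel_coeff nu) n
  = / Gamma (nu + 1) ^ 2 * kummer_sum n (nu + 1) (nu + 1).
Proof.
  intros Hnu. unfold cauchy_coeff, kummer_sum, alt_bessel_coeff. rewrite scal_sum.
  apply sum_eq. intros k Hk.
  rewrite !bessel_coeff_eq by assumption. unfold kummer_term.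
  assert (H1 := INR_fact_neq_0 k). assert (H2 := INR_fact_neq_0 (n - k)).
  assert (H4 := pochhammer_pos (nu + 1) k ltac:(lra)).
  assert (H5 := pochhammer_pos (nu + 1) (n - k) ltac:(lra)).
  assert (H6 := Gamma_pos (nu + 1) ltac:(lra)). field. repeat split; lra.
Qed.

Lemma bessel_series_product (nu : R) (z : C) :
  -1 < nu ->
  is_cseries (fun m => RtoC ((-1) ^ m * v_coeff (nu + 1) m) * z ^ (4 * m))%C
    (RtoC (Gamma (nu + 1) ^ 2) *
     (cpow_series (alt_bessel_coeff nu) ((z / 2) ^ 2)
      * cpow_series (bessel_coeff nu) ((z / 2) ^ 2)))%C.
Proof.
  intros Hnu.
  assert (HG := Gamma_pos (nu + 1) ltac:(lra)).
  assert (Hp : forall n, 0 <= bessel_coeff nu n).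
  { intros n. rewrite bessel_coeff_eq by assumption. apply Rlt_le, Rdiv_lt_0_compat; [lra|].
    repeat apply Rmult_lt_0_compat; [apply INR_fact_lt_0|apply pochhammer_pos; lra|lra]. }
  set (y := ((z / 2) ^ 2)%C).
  assert (Hs := ex_series_bessel_coeff nu (Cmod y) Hnu (Cmod_ge_0 y)).
  assert (Hprod := cpow_series_mult (alt_bessel_coeff nu)
    (bessel_coeff nu) y).
  assert (Hprod' := Hprod
    ltac:(revert Hs; apply ex_series_ext; intros n;
          unfold alt_bessel_coeff; rewrite Rabs_mult, pow_1_abs, Rmult_1_l,
            (Rabs_pos_eq (bessel_coeff nu n)) by apply Hp;
          reflexivity)
    ltac:(revert Hs; apply ex_series_ext; intros n; rewrite Rabs_pos_eq by apply Hp;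
          reflexivity)).
  apply is_cseries_even in Hprod'.
  - apply (is_cseries_scal (RtoC (Gamma (nu + 1) ^ 2))) in Hprod'.
    revert Hprod'. apply is_cseries_ext. intros m.
    rewrite conv_bessel, kummer_sum_even by lra.
    replace (y ^ (2 * m))%C with (RtoC (/ 16 ^ m) * z ^ (4 * m))%C.
    + rewrite !Cmult_assoc, <- !RtoC_mult. f_equal. f_equal. unfold v_coeff.
      assert (H1 := INR_fact_neq_0 m).
      assert (H4 := pochhammer_pos (nu + 1) m ltac:(lra)).
      assert (H5 := pochhammer_pos (nu + 1) (2 * m) ltac:(lra)).
      assert (H6 : 16 ^ m <> 0) by (apply pow_nonzero; lra).
      field. repeat split; lra.
    + unfold y. rewrite !Cpow_mult_r, <- pow_inv, RtoC_pow, <- Cpow_mult_l. f_equal.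
      apply injective_projections; destruct z; simpl; field.
  - intros m. rewrite conv_bessel, kummer_sum_odd by lra. rewrite Rmult_0_r. ring.
Qed.

Lemma v_series (nu : R) (z : C) :
  -1 < nu ->
  v nu z = CSeries (fun n => RtoC ((-1) ^ n * v_coeff (nu + 1) n) * z ^ (4 * n + 1))%C.
Proof.
  intros Hnu.
  assert (H := bessel_series_product nu z Hnu).
  apply (is_cseries_scal z) in H.
  rewrite (is_cseries_unique _ (z * (RtoC (Gamma (nu + 1) ^ 2) *
     (cpow_series (alt_bessel_coeff nu) ((z / 2) ^ 2)
      * cpow_series (bessel_coeff nu) ((z / 2) ^ 2))))%C).
  2: { revert H. apply is_cseries_ext. intros n. rewrite Cpow_add_r, Cpow_1_r. ring. }
  destruct (Ceq_dec z 0) as [->|Hz].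
  - rewrite v_0. ring.
  - unfold v, BesselProd, BesselJ, BesselI.
    replace (CSeries (fun n => RtoC ((-1) ^ n / (INR (fact n) * Gamma (nu + INR n + 1)))
       * (z / 2) ^ (2 * n)))%C
      with (cpow_series (alt_bessel_coeff nu) ((z / 2) ^ 2)).
    + replace (CSeries (fun n => RtoC (1 / (INR (fact n) * Gamma (nu + INR n + 1)))
        * (z / 2) ^ (2 * n)))%C
      with (cpow_series (bessel_coeff nu) ((z / 2) ^ 2)).
      * generalize (Cpower_cancel nu z Hz).
        generalize (cpow_series (alt_bessel_coeff nu) ((z / 2) ^ 2))
          (cpow_series (bessel_coeff nu) ((z / 2) ^ 2)) (Cpower (z / 2) nu)
          (RtoC (Gamma (nu + 1) ^ 2)) (RtoC (Rpower 2 (2 * nu)) * Cpower z (-2 * nu + 1))%C.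
        intros sJ sI p G q E. rewrite <- E. ring.
      * apply CSeries_ext. intros n. now rewrite Cpow_mult_r.
    + apply CSeries_ext. intros n. rewrite Cpow_mult_r. unfold alt_bessel_coeff, bessel_coeff, Rdiv.
      now rewrite Rmult_1_l.
Qed.

(** * Reciprocals of rapidly decaying alternating series *)

(** The list holds its last term first, so that w_j x_n - w_(j+1) x_(n-1) + ... is
    computed by recursion on it. *)
Fixpoint alt_sum (w : nat -> R) (j : nat) (l : list R) : R :=
  match l with
  | nil => 0
  | x :: l' => w j * x - alt_sum w (S j) l'
  end.

(** The coefficients q_n, ..., q_0 of the reciprocal of sum (-1)^n b_n w^n with
    b_0 = 1. Every coefficient depends on all the previous ones, which is why the whole
    list is carried along. *)
Fixpoint recip_list (b : nat -> R) (n : nat) : list R :=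
  match n with
  | O => 1 :: nil
  | S m => alt_sum b 1 (recip_list b m) :: recip_list b m
  end.

Definition recip_coeff (b : nat -> R) (n : nat) : R := hd 0 (recip_list b n).

(** The effect of w d/dw on coefficients. *)
Definition euler_coeff (b : nat -> R) (n : nat) : R := INR n * b n.

(** The coefficients of -w phi'(w) / phi(w) for phi(w) = sum (-1)^n b_n w^n: the
    product of -w phi'(w) with the reciprocal series. *)
Definition logderiv_coeff (b : nat -> R) (n : nat) : R :=
  match n with
  | O => 0
  | S m => alt_sum (euler_coeff b) 1 (recip_list b m)
  end.

Definition alt_coeff (b : nat -> R) (n : nat) : R := (-1) ^ n * b n.

Lemma alt_sum_recip_list_S (b w : nat -> R) (j n : nat) :
  alt_sum w j (recip_list b (S n))
  = w j * recip_coeff b (S n) - alt_sum w (S j) (recip_list b n).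
Proof. reflexivity. Qed.

Lemma alt_sum_recip_list (b w : nat -> R) (n j : nat) :
  alt_sum w j (recip_list b n)
  = sum_f_R0 (fun k => (-1) ^ k * w (j + k)%nat * recip_coeff b (n - k)) n.
Proof.
  revert j. induction n as [|n IH]; intros j.
  - simpl. unfold recip_coeff; simpl. rewrite Nat.add_0_r. ring.
  - rewrite alt_sum_recip_list_S, IH, (decomp_sum _ (S n)) by lia. simpl pred.
    rewrite Nat.add_0_r, Nat.sub_0_r. simpl ((-1) ^ 0).
    rewrite (sum_eq (fun i => (-1) ^ S i * w (j + S i)%nat * recip_coeff b (S n - S i))
      (fun k => (-1) ^ k * w (S j + k)%nat * recip_coeff b (n - k) * -1)).
    + rewrite <- scal_sum. ring.
    + intros i Hi. replace (j + S i)%nat with (S j + i)%nat by lia.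
      replace (S n - S i)%nat with (n - i)%nat by lia. simpl pow. ring.
Qed.

Lemma conv_alt_recip (b w : nat -> R) (n : nat) :
  cauchy_coeff (alt_coeff w) (recip_coeff b) (S n)
  = w 0%nat * recip_coeff b (S n) - alt_sum w 1 (recip_list b n).
Proof.
  unfold cauchy_coeff. rewrite decomp_sum by lia. simpl pred. rewrite Nat.sub_0_r.
  rewrite alt_sum_recip_list. unfold alt_coeff at 1. simpl ((-1) ^ 0).
  rewrite (sum_eq (fun i => alt_coeff w (S i) * recip_coeff b (S n - S i))
      (fun k => (-1) ^ k * w (1 + k)%nat * recip_coeff b (n - k) * -1)).
  - rewrite <- scal_sum. ring.
  - intros i Hi. unfold alt_coeff.
    replace (S n - S i)%nat with (n - i)%nat by lia. simpl. ring.
Qed.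

(** The factor 1/4 is what makes the bounds on ratios in [recip_bounds] reproduce
    themselves. *)
Definition fast_decay (b : nat -> R) : Prop :=
  b 0%nat = 1 /\ (forall n, 0 < b n) /\
  (forall n, (1 <= n)%nat -> b (S n) <= b 1%nat / 4 * b n).

(** If the ratios of consecutive q_m are at least b_1/2 and those of the weights at
    most b_1/2, the terms of the alternating sum decrease. *)
Lemma alt_sum_bounds (b w : nat -> R) (n : nat) :
  (forall m, (m <= n)%nat -> 0 < recip_coeff b m) ->
  (forall m, (m < n)%nat -> b 1%nat / 2 * recip_coeff b m <= recip_coeff b (S m)) ->
  (forall k, (1 <= k)%nat -> 0 <= w k /\ w (S k) <= b 1%nat / 2 * w k) ->
  forall j, (1 <= j)%nat ->
  0 <= alt_sum w j (recip_list b n) <= w j * recip_coeff b n.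
Proof.
  intros Hp Hr Hw. induction n as [|n IH]; intros j Hj.
  - unfold recip_coeff; simpl. destruct (Hw j Hj). lra.
  - rewrite alt_sum_recip_list_S.
    destruct (IH ltac:(auto with arith) ltac:(auto with arith) (S j) ltac:(lia)) as [L U].
    destruct (Hw j Hj) as [W0 W1].
    assert (P := Hp n ltac:(lia)). assert (Q := Hr n ltac:(lia)).
    assert (w (S j) * recip_coeff b n <= w j * recip_coeff b (S n)); [|lra].
    apply Rle_trans with (b 1%nat / 2 * w j * recip_coeff b n).
    + apply Rmult_le_compat_r; lra.
    + replace (b 1%nat / 2 * w j * recip_coeff b n) with (w j * (b 1%nat / 2 * recip_coeff b n)) by ring.
      now apply Rmult_le_compat_l.
Qed.

(** The recurrence reads q_(n+1) = b_1 q_n - (b_2 q_(n-1) - ...), with the bracket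
    between 0 and b_2 q_(n-1) <= (b_1^2/4) (2/b_1) q_n = (b_1/2) q_n, so the bounds on the
    ratio propagate. *)
Lemma recip_bounds (b : nat -> R) (n : nat) :
  fast_decay b ->
  0 < recip_coeff b n /\
  b 1%nat / 2 * recip_coeff b n <= recip_coeff b (S n) <= b 1%nat * recip_coeff b n.
Proof.
  intros (H0 & Hpos & Hd).
  assert (H1 := Hpos 1%nat).
  induction n as [n IH] using (well_founded_induction Wf_nat.lt_wf).
  assert (Pn : 0 < recip_coeff b n).
  { destruct n as [|m]; [unfold recip_coeff; simpl; lra|].
    destruct (IH m ltac:(lia)) as (P & L & U). nra. }
  split; [exact Pn|].
  change (recip_coeff b (S n)) with (alt_sum b 1 (recip_list b n)).
  destruct n as [|m].
  - unfold recip_coeff; simpl. lra.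
  - rewrite alt_sum_recip_list_S.
    destruct (IH m ltac:(lia)) as (P & L & U).
    destruct (alt_sum_bounds b b m) with (j := 2%nat) as [A B].
    + intros k Hk. apply (IH k); lia.
    + intros k Hk. apply (IH k); lia.
    + intros k Hk. split; [now apply Rlt_le|].
      assert (X := Hd k Hk). assert (Y := Hpos k). nra.
    + lia.
    + assert (X := Hd 1%nat (le_n 1)).
      assert (b 2%nat * recip_coeff b m <= b 1%nat / 4 * b 1%nat * recip_coeff b m).
      { apply Rmult_le_compat_r; lra. }
      nra.
Qed.

(** The weights k b_k still decrease by a factor b_1/2, since (k+1)/k <= 2. *)
Lemma logderiv_bounds (b : nat -> R) (n : nat) :
  fast_decay b -> 0 <= logderiv_coeff b (S n) <= b 1%nat * recip_coeff b n.
Proof.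
  intros Hb. assert (Hb' := Hb). destruct Hb' as (H0 & Hpos & Hd).
  destruct (alt_sum_bounds b (euler_coeff b) n) with (j := 1%nat) as [A B].
  - intros m _. apply (recip_bounds b m Hb).
  - intros m _. apply (recip_bounds b m Hb).
  - intros k Hk. unfold euler_coeff. assert (X := Hd k Hk). assert (Y := Hpos k).
    apply le_INR in Hk. simpl (INR 1) in Hk. split; [nra|].
    rewrite S_INR.
    apply Rle_trans with ((INR k + 1) * (b 1%nat / 4 * b k)).
    + apply Rmult_le_compat_l; lra.
    + assert (Z := Hpos 1%nat). assert (0 < b 1%nat * b k) by nra. nra.
  - lia.
  - unfold euler_coeff at 2 in B. simpl (INR 1) in B. rewrite Rmult_1_l in B. now split.
Qed.

Lemma recip_le_pow (b : nat -> R) (n : nat) : fast_decay b -> recip_coeff b n <= b 1%nat ^ n.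
Proof.
  intros Hb. assert (H1 := proj1 (proj2 Hb) 1%nat).
  induction n as [|n IH]; [unfold recip_coeff; simpl; lra|].
  destruct (recip_bounds b n Hb) as (P & _ & U). simpl. nra.
Qed.

Lemma fast_decay_le (b : nat -> R) (n : nat) :
  fast_decay b -> b n <= 4 * (b 1%nat / 4) ^ n.
Proof.
  intros (H0 & Hpos & Hd). destruct n as [|n]; [simpl; lra|].
  induction n as [|n IH]; [simpl; lra|].
  eapply Rle_trans; [apply Hd; lia|].
  rewrite <- tech_pow_Rmult. assert (H1 := Hpos 1%nat). nra.
Qed.

Lemma ex_series_geom_bound (d : nat -> R) (K B r : R) :
  (forall n, 0 <= d n <= K * B ^ n) -> 0 <= B -> 0 <= r -> B * r < 1 ->
  ex_series (fun n => d n * r ^ n).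
Proof.
  intros Hd HB Hr HBr.
  apply (ex_series_le (V := R_CompleteNormedModule)) with (fun n => K * (B * r) ^ n).
  - intros n. unfold norm; simpl; unfold abs; simpl.
    assert (Hrn : 0 <= r ^ n) by now apply pow_le.
    destruct (Hd n). rewrite Rabs_pos_eq by now apply Rmult_le_pos.
    rewrite Rpow_mult_distr, <- Rmult_assoc. now apply Rmult_le_compat_r.
  - apply (ex_series_scal_l (V := R_NormedModule)). apply ex_series_geom.
    rewrite Rabs_pos_eq; auto. now apply Rmult_le_pos.
Qed.

Lemma ex_series_recip (b : nat -> R) (Hb : fast_decay b) (r : R) :
  0 <= r -> b 1%nat * r < 1 -> ex_series (fun n => recip_coeff b n * r ^ n).
Proof.
  intros Hr H. assert (b1_pos := proj1 (proj2 Hb) 1%nat).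
  apply ex_series_geom_bound with 1 (b 1%nat); auto; [|lra].
  intros n. split; [apply Rlt_le, (recip_bounds b n Hb)|].
  rewrite Rmult_1_l. now apply recip_le_pow.
Qed.

Lemma logderiv_nonneg (b : nat -> R) (Hb : fast_decay b) (n : nat) : 0 <= logderiv_coeff b n.
Proof. destruct n; [simpl; lra|]. now apply logderiv_bounds. Qed.

Lemma ex_series_logderiv (b : nat -> R) (Hb : fast_decay b) (r : R) :
  0 <= r -> b 1%nat * r < 1 -> ex_series (fun n => logderiv_coeff b n * r ^ n).
Proof.
  intros Hr H. assert (b1_pos := proj1 (proj2 Hb) 1%nat).
  apply ex_series_geom_bound with 1 (b 1%nat); auto; [|lra].
  intros n. split; [apply (logderiv_nonneg b Hb)|]. rewrite Rmult_1_l.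
  destruct n as [|n]; [simpl; lra|].
  eapply Rle_trans; [apply logderiv_bounds, Hb|].
  simpl. apply Rmult_le_compat_l; [lra|]. now apply recip_le_pow.
Qed.

Lemma ex_series_fast_decay (b : nat -> R) (Hb : fast_decay b) (r : R) :
  0 <= r -> b 1%nat * r < 1 -> ex_series (fun n => Rabs (alt_coeff b n) * r ^ n).
Proof.
  intros Hr H. assert (b1_pos := proj1 (proj2 Hb) 1%nat).
  apply ex_series_geom_bound with 4 (b 1%nat); auto; [|lra].
  intros n. split; [apply Rabs_pos|].
  unfold alt_coeff. rewrite Rabs_mult, pow_1_abs, Rmult_1_l.
  rewrite Rabs_pos_eq by apply Rlt_le, Hb.
  eapply Rle_trans; [now apply fast_decay_le|].
  apply Rmult_le_compat_l; [lra|]. apply pow_incr. lra.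
Qed.

Lemma ex_series_fast_decay_deriv (b : nat -> R) (Hb : fast_decay b) (r : R) :
  0 <= r -> b 1%nat * r < 1 ->
  ex_series (fun n => Rabs (alt_coeff (euler_coeff b) n) * r ^ n).
Proof.
  intros Hr H. assert (b1_pos := proj1 (proj2 Hb) 1%nat).
  apply ex_series_geom_bound with 4 (b 1%nat); auto; [|lra].
  intros n. split; [apply Rabs_pos|].
  unfold alt_coeff, euler_coeff. rewrite Rabs_mult, pow_1_abs, Rmult_1_l.
  assert (Hp : 0 < b n) by apply Hb. assert (Hn := pos_INR n).
  rewrite Rabs_pos_eq by nra.
  apply Rle_trans with (2 ^ n * (4 * (b 1%nat / 4) ^ n)).
  - apply Rmult_le_compat; try lra; [|now apply fast_decay_le].
    clear. induction n; [simpl; lra|]. rewrite S_INR. simpl.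
    assert (1 <= 2 ^ n) by (apply pow_R1_Rle; lra). lra.
  - replace (2 ^ n * (4 * (b 1%nat / 4) ^ n)) with (4 * (2 * (b 1%nat / 4)) ^ n)
      by (rewrite Rpow_mult_distr; ring).
    apply Rmult_le_compat_l; [lra|]. apply pow_incr. lra.
Qed.

(** By construction of the recurrence, the Cauchy product has all coefficients
    of positive index equal to 0. *)
Lemma cpow_series_recip (b : nat -> R) (Hb : fast_decay b) (w : C) :
  b 1%nat * Cmod w < 1 ->
  (cpow_series (alt_coeff b) w * cpow_series (recip_coeff b) w)%C = 1%C.
Proof.
  intros Hw. assert (Hm := Cmod_ge_0 w).
  assert (H := cpow_series_mult (alt_coeff b) (recip_coeff b) w
    (ex_series_fast_decay b Hb _ Hm Hw)).
  assert (H' := H ltac:(generalize (ex_series_recip b Hb _ Hm Hw); apply ex_series_ext;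
     intros n; rewrite Rabs_pos_eq; auto; apply Rlt_le, (recip_bounds b n Hb))).
  rewrite <- (is_cseries_unique _ _ H').
  assert (Hc : forall n, cauchy_coeff (alt_coeff b) (recip_coeff b) (S n) = 0).
  { intros n. rewrite conv_alt_recip, (proj1 Hb).
    change (recip_coeff b (S n)) with (alt_sum b 1 (recip_list b n)). ring. }
  assert (H0 : cauchy_coeff (alt_coeff b) (recip_coeff b) 0 = 1).
  { unfold cauchy_coeff, alt_coeff, recip_coeff; simpl. rewrite (proj1 Hb). ring. }
  apply is_cseries_unique.
  assert (S1 : forall f : nat -> R, (forall n, f (S n) = 0) -> is_series f (f 0%nat)).
  { clear. intros f Hf. apply (is_series_decr_1 (V := R_NormedModule)).
    unfold plus, opp; simpl. rewrite Rplus_opp_r.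
    change (is_lim_seq (sum_n (fun k => f (S k))) 0).
    apply (is_lim_seq_ext (fun _ => 0)); [|apply is_lim_seq_const].
    induction n as [|n IH].
    - now rewrite sum_O, Hf.
    - rewrite sum_Sn, <- IH, Hf. unfold plus; simpl; ring. }
  split.
  - generalize (S1 (fun n => Re (RtoC (cauchy_coeff (alt_coeff b) (recip_coeff b) n) * w ^ n))).
    rewrite H0. replace (Re (1 * w ^ 0)) with (Re 1) by (simpl; ring).
    intros A; apply A. intros n. rewrite Hc. rewrite re_scal_l. ring.
  - generalize (S1 (fun n => Im (RtoC (cauchy_coeff (alt_coeff b) (recip_coeff b) n) * w ^ n))).
    rewrite H0. replace (Im (1 * w ^ 0)) with (Im 1) by (simpl; ring).
    intros A; apply A. intros n. rewrite Hc. rewrite im_scal_l. ring.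
Qed.

Lemma cpow_series_logderiv (b : nat -> R) (Hb : fast_decay b) (w : C) :
  b 1%nat * Cmod w < 1 ->
  (cpow_series (alt_coeff (euler_coeff b)) w * cpow_series (recip_coeff b) w)%C
  = (- cpow_series (logderiv_coeff b) w)%C.
Proof.
  intros Hw. assert (Hm := Cmod_ge_0 w).
  assert (H := cpow_series_mult (alt_coeff (euler_coeff b)) (recip_coeff b) w
    (ex_series_fast_decay_deriv b Hb _ Hm Hw)).
  assert (H' := H ltac:(generalize (ex_series_recip b Hb _ Hm Hw); apply ex_series_ext;
     intros n; rewrite Rabs_pos_eq; auto; apply Rlt_le, (recip_bounds b n Hb))).
  rewrite <- (is_cseries_unique _ _ H').
  apply is_cseries_unique.
  replace (- cpow_series (logderiv_coeff b) w)%C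
    with (RtoC (-1) * cpow_series (logderiv_coeff b) w)%C by ring.
  eapply is_cseries_ext.
  2: { apply is_cseries_scal. apply CSeries_correct.
       generalize (ex_series_logderiv b Hb _ Hm Hw). apply ex_series_ext. intros n.
       rewrite Cmod_mult, Cmod_R, Cmod_pow, Rabs_pos_eq; auto. apply (logderiv_nonneg b Hb). }
  intros n. simpl. rewrite Cmult_assoc, <- RtoC_mult. f_equal. f_equal.
  destruct n as [|n].
  - unfold cauchy_coeff, alt_coeff, euler_coeff; simpl. ring.
  - rewrite conv_alt_recip. unfold euler_coeff at 1. simpl. ring.
Qed.

Lemma cpow_series_RtoC (a : nat -> R) (r : R) :
  cpow_series a (RtoC r) = RtoC (Series (fun n => a n * r ^ n)).
Proof.
  assert (E : forall n, (RtoC (a n) * RtoC r ^ n)%C = RtoC (a n * r ^ n)).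
  { intros n. now rewrite <- RtoC_pow, <- RtoC_mult. }
  unfold cpow_series. rewrite (CSeries_ext _ _ E).
  apply injective_projections; simpl; [reflexivity|].
  rewrite (Series_ext _ (fun n => 0 * 0)) by (intros n; simpl; ring).
  rewrite Series_scal_l. ring.
Qed.

Definition log_derivative (b : nat -> R) (w : C) : C :=
  (cpow_series (alt_coeff (euler_coeff b)) w / cpow_series (alt_coeff b) w)%C.

Lemma cpow_series_alt_neq_0 (b : nat -> R) (Hb : fast_decay b) (w : C) :
  b 1%nat * Cmod w < 1 -> cpow_series (alt_coeff b) w <> 0%C.
Proof.
  intros Hw E. assert (H := cpow_series_recip b Hb w Hw). rewrite E in H.
  rewrite Cmult_0_l in H. injection H. lra.
Qed.

Lemma log_derivative_eq (b : nat -> R) (Hb : fast_decay b) (w : C) :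
  b 1%nat * Cmod w < 1 -> log_derivative b w = (- cpow_series (logderiv_coeff b) w)%C.
Proof.
  intros Hw. rewrite <- cpow_series_logderiv by assumption.
  assert (H := cpow_series_recip b Hb w Hw). assert (N := cpow_series_alt_neq_0 b Hb w Hw).
  unfold log_derivative. unfold Cdiv. f_equal.
  replace (cpow_series (recip_coeff b) w)
    with (/ cpow_series (alt_coeff b) w
          * (cpow_series (alt_coeff b) w * cpow_series (recip_coeff b) w))%C by (field; auto).
  rewrite H. ring.
Qed.

(** The series of -w phi'/phi has nonnegative coefficients, so its real part at w is
    at most its value at |w|, and it increases on the positive axis. *)
Lemma Re_log_derivative_min (b : nat -> R) (Hb : fast_decay b) (w : C) (r : R) :
  Cmod w <= r -> b 1%nat * r < 1 ->
  Re (log_derivative b (RtoC r)) <= Re (log_derivative b w).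
Proof.
  intros Hw Hr. assert (Hm := Cmod_ge_0 w).
  assert (b1_pos := proj1 (proj2 Hb) 1%nat).
  assert (Hbw : b 1%nat * Cmod w < 1).
  { apply Rle_lt_trans with (2 := Hr). apply Rmult_le_compat_l; lra. }
  assert (Hcr : Cmod (RtoC r) = r) by (rewrite Cmod_R; apply Rabs_pos_eq; lra).
  rewrite !log_derivative_eq by (rewrite ?Hcr; assumption).
  rewrite !re_opp, cpow_series_RtoC. simpl (Re (RtoC _)).
  apply Ropp_le_contravar. apply Re_CSeries_le.
  - intros n. rewrite Cmod_mult, Cmod_R, Cmod_pow.
    rewrite Rabs_pos_eq by apply (logderiv_nonneg b Hb).
    apply Rmult_le_compat_l; [apply (logderiv_nonneg b Hb)|]. apply pow_incr. lra.
  - apply (ex_series_logderiv b Hb); lra.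
Qed.

(** At a real point phi (1 + k w phi'/phi) is the series with weights 1 + k n, and
    Q = 1/phi is positive because its coefficients are. *)
Lemma Re_log_derivative_sign (b : nat -> R) (Hb : fast_decay b) (k r : R) :
  0 <= r -> b 1%nat * r < 1 ->
  exists Q, 0 < Q /\
  Re (1 + RtoC k * log_derivative b (RtoC r))%C
  = Q * Series (fun n => (-1) ^ n * ((1 + k * INR n) * b n) * r ^ n).
Proof.
  intros Hr Hbr.
  assert (Hcr : Cmod (RtoC r) = r) by (rewrite Cmod_R; apply Rabs_pos_eq; lra).
  assert (Hw : b 1%nat * Cmod (RtoC r) < 1) by now rewrite Hcr.
  exists (Series (fun n => recip_coeff b n * r ^ n)). split.
  - rewrite Series_incr_1 by now apply ex_series_recip.
    replace (recip_coeff b 0 * r ^ 0) with 1 by (unfold recip_coeff; simpl; ring).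
    assert (0 <= Series (fun n => recip_coeff b (S n) * r ^ S n)); [|lra].
    apply Rle_trans with (Series (fun n => 0 * 0)); [rewrite Series_scal_l; lra|].
    apply Series_le.
    + intros n. rewrite Rmult_0_l. split; [lra|].
      apply Rmult_le_pos; [apply Rlt_le, (recip_bounds b _ Hb)|now apply pow_le].
    + apply (ex_series_incr_1 (fun n => recip_coeff b n * r ^ n)), ex_series_recip; auto.
  - assert (H := cpow_series_recip b Hb _ Hw). assert (N := cpow_series_alt_neq_0 b Hb _ Hw).
    replace (1 + RtoC k * log_derivative b (RtoC r))%C
      with (cpow_series (recip_coeff b) (RtoC r) * (cpow_series (alt_coeff b) (RtoC r)
            + RtoC k * cpow_series (alt_coeff (euler_coeff b)) (RtoC r)))%C.
    + rewrite !cpow_series_RtoC. rewrite <- RtoC_mult, <- RtoC_plus, <- RtoC_mult.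
      simpl. f_equal. rewrite <- Series_scal_l, <- Series_plus.
      * apply Series_ext. intros n. unfold alt_coeff, euler_coeff. ring.
      * apply ex_series_Rabs. generalize (ex_series_fast_decay b Hb r Hr Hbr).
        apply ex_series_ext. intros n. rewrite (Rabs_mult _ (r ^ n)), (Rabs_pos_eq (r ^ n)); auto.
        now apply pow_le.
      * apply (ex_series_scal_l (V := R_NormedModule)).
        apply ex_series_Rabs. generalize (ex_series_fast_decay_deriv b Hb r Hr Hbr).
        apply ex_series_ext. intros n. rewrite (Rabs_mult _ (r ^ n)), (Rabs_pos_eq (r ^ n)); auto.
        now apply pow_le.
    + unfold log_derivative.
      replace (cpow_series (recip_coeff b) (RtoC r))
        with (/ cpow_series (alt_coeff b) (RtoC r)
          * (cpow_series (alt_coeff b) (RtoC r) * cpow_series (recip_coeff b) (RtoC r)))%C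
        by (field; auto).
      rewrite H. field. auto.
Qed.

(** * The convexity criterion *)

Lemma v_coeff_pos (a : R) (n : nat) : 0 < a -> 0 < v_coeff a n.
Proof.
  intros Ha. unfold v_coeff. apply Rdiv_lt_0_compat; [lra|].
  repeat apply Rmult_lt_0_compat; try now apply pochhammer_pos.
  - apply pow_lt; lra.
  - apply INR_fact_lt_0.
Qed.

Lemma v_coeff_S (a : R) (n : nat) :
  0 < a ->
  v_coeff a (S n)
  = / (16 * (a + INR n) * (a + 2 * INR n) * (a + 2 * INR n + 1)) / INR (S n) * v_coeff a n.
Proof.
  intros Ha. unfold v_coeff. replace (2 * S n)%nat with (S (S (2 * n))) by lia.
  rewrite fact_simpl, mult_INR.
  change (pochhammer a (S (S (2 * n)))) with
    (pochhammer a (2 * n) * (a + INR (2 * n)) * (a + INR (S (2 * n)))).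
  change (pochhammer a (S n)) with (pochhammer a n * (a + INR n)).
  rewrite (S_INR (2 * n)), mult_INR. simpl (INR 2).
  assert (H1 := INR_fact_neq_0 n). assert (Hn := pos_INR n).
  assert (H3 := not_0_INR (S n) ltac:(lia)).
  assert (H4 := pochhammer_pos a n Ha).
  assert (H5 := pochhammer_pos a (2 * n) Ha).
  assert (H6 : 16 ^ n <> 0) by (apply pow_nonzero; lra).
  simpl (16 ^ S n). field. repeat split; lra.
Qed.

(** For p = 1 the coefficients of v', and for p = 2 those of the numerator
    (z v')' of 1 + z v''/v', both as series in z^4 and up to sign. *)
Definition weighted_coeff (a : R) (p n : nat) : R := INR (4 * n + 1) ^ p * v_coeff a n.

Lemma INR_4n1 (n : nat) : INR (4 * n + 1) = 4 * INR n + 1.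
Proof. rewrite plus_INR, mult_INR. simpl. ring. Qed.

Lemma weighted_coeff_pos (a : R) (p n : nat) : 0 < a -> 0 < weighted_coeff a p n.
Proof.
  intros Ha. apply Rmult_lt_0_compat; [|now apply v_coeff_pos].
  apply pow_lt. rewrite INR_4n1. generalize (pos_INR n). lra.
Qed.

Lemma weighted_coeff_S_le (a : R) (p n : nat) :
  0 < a ->
  weighted_coeff a p (S n) <= 5 ^ p * / (16 * a ^ 2 * (a + 1)) / INR (S n) * weighted_coeff a p n.
Proof.
  intros Ha. unfold weighted_coeff. rewrite v_coeff_S by assumption.
  assert (Hg := v_coeff_pos a n Ha). assert (Hn := pos_INR n).
  assert (HS : 0 < INR (S n)) by (apply lt_0_INR; lia).
  set (g := v_coeff a n) in *.
  assert (A : INR (4 * S n + 1) ^ p <= 5 ^ p * INR (4 * n + 1) ^ p).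
  { rewrite <- Rpow_mult_distr. apply pow_incr. rewrite !INR_4n1, S_INR. lra. }
  assert (A0 : 0 <= INR (4 * S n + 1) ^ p) by (apply pow_le, pos_INR).
  assert (B : / (16 * (a + INR n) * (a + 2 * INR n) * (a + 2 * INR n + 1))
              <= / (16 * a ^ 2 * (a + 1))).
  { apply Rinv_le_contravar.
    - repeat apply Rmult_lt_0_compat; lra.
    - replace (16 * a ^ 2 * (a + 1)) with (16 * a * a * (a + 1)) by ring.
      repeat apply Rmult_le_compat; try lra; repeat apply Rmult_le_pos; lra. }
  assert (B0 : 0 <= / (16 * (a + INR n) * (a + 2 * INR n) * (a + 2 * INR n + 1))).
  { apply Rlt_le, Rinv_0_lt_compat. repeat apply Rmult_lt_0_compat; lra. }
  set (i1 := / (16 * (a + INR n) * (a + 2 * INR n) * (a + 2 * INR n + 1))) in *.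
  set (i2 := / (16 * a ^ 2 * (a + 1))) in *.
  replace (INR (4 * S n + 1) ^ p * (i1 / INR (S n) * g))
    with (INR (4 * S n + 1) ^ p * i1 * (g / INR (S n))) by (field; lra).
  replace (5 ^ p * i2 / INR (S n) * (INR (4 * n + 1) ^ p * g))
    with (5 ^ p * INR (4 * n + 1) ^ p * i2 * (g / INR (S n))) by (field; lra).
  apply Rmult_le_compat_r.
  - apply Rlt_le, Rdiv_lt_0_compat; lra.
  - now apply Rmult_le_compat.
Qed.

Lemma ex_series_weighted_coeff (a r : R) (p : nat) :
  0 < a -> 0 <= r -> ex_series (fun n => weighted_coeff a p n * r ^ n).
Proof.
  intros Ha Hr.
  apply ex_series_factorial_decay with (5 ^ p * / (16 * a ^ 2 * (a + 1))); auto.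
  - apply Rmult_le_pos; [apply pow_le; lra|]. apply Rlt_le, Rinv_0_lt_compat.
    assert (0 < a ^ 2) by (apply pow_lt; lra). nra.
  - intros n; now apply Rlt_le, weighted_coeff_pos.
  - intros n. now apply weighted_coeff_S_le.
Qed.

Lemma weighted_coeff_0 (a : R) (p : nat) : weighted_coeff a p 0 = 1.
Proof. unfold weighted_coeff, v_coeff; simpl. rewrite pow1. field. Qed.

Lemma weighted_coeff_1 (a : R) (p : nat) :
  0 < a -> weighted_coeff a p 1 = 5 ^ p * / (16 * a ^ 2 * (a + 1)).
Proof.
  intros Ha. unfold weighted_coeff, v_coeff. simpl. replace (1 + 1 + 1 + 1 + 1) with 5 by ring.
  field. lra.
Qed.

(** The ratio g_(n+1) / g_n = 1 / (16 (n+1) (a+n) (a+2n) (a+2n+1)) is, apart from the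
    factor 1/(n+1), at most its value at n = 0. It remains that
    ((4n+5)/(4n+1))^p / (n+1) <= 5^p / 4 for n >= 1. *)
Lemma fast_decay_weighted_coeff (a : R) (p : nat) :
  0 < a -> (1 <= p <= 2)%nat -> fast_decay (weighted_coeff a p).
Proof.
  intros Ha Hp. split; [apply weighted_coeff_0|]. split; [intros n; now apply weighted_coeff_pos|].
  intros n Hn. rewrite weighted_coeff_1 by assumption.
  unfold weighted_coeff. rewrite v_coeff_S by assumption.
  assert (Hg := v_coeff_pos a n Ha). apply le_INR in Hn. simpl (INR 1) in Hn.
  rewrite !INR_4n1, S_INR. set (N := INR n) in *.
  assert (B : / (16 * (a + N) * (a + 2 * N) * (a + 2 * N + 1)) <= / (16 * a ^ 2 * (a + 1))).
  { apply Rinv_le_contravar.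
    - assert (0 < a ^ 2) by (apply pow_lt; lra). nra.
    - replace (16 * a ^ 2 * (a + 1)) with (16 * a * a * (a + 1)) by ring.
      repeat apply Rmult_le_compat; try lra; repeat apply Rmult_le_pos; lra. }
  assert (B0 : 0 <= / (16 * (a + N) * (a + 2 * N) * (a + 2 * N + 1))).
  { apply Rlt_le, Rinv_0_lt_compat. repeat apply Rmult_lt_0_compat; lra. }
  set (i1 := / (16 * (a + N) * (a + 2 * N) * (a + 2 * N + 1))) in *.
  set (i2 := / (16 * a ^ 2 * (a + 1))) in *.
  assert (A : (4 * (N + 1) + 1) ^ p / (N + 1) <= 5 ^ p / 4 * (4 * N + 1) ^ p).
  { apply Rmult_le_reg_r with (N + 1); [lra|]. field_simplify; [|lra].
    assert (p = 1 \/ p = 2)%nat as [-> | ->] by lia; simpl; nra. }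
  replace ((4 * (N + 1) + 1) ^ p * (i1 / (N + 1) * v_coeff a n))
    with ((4 * (N + 1) + 1) ^ p / (N + 1) * i1 * v_coeff a n) by (field; lra).
  replace (5 ^ p * i2 / 4 * ((4 * N + 1) ^ p * v_coeff a n))
    with (5 ^ p / 4 * (4 * N + 1) ^ p * i2 * v_coeff a n) by field.
  apply Rmult_le_compat_r; [lra|].
  apply Rmult_le_compat; auto.
  apply Rmult_le_pos; [apply pow_le; lra|]. apply Rlt_le, Rinv_0_lt_compat; lra.
Qed.

Lemma is_derive_v (nu : R) (z : C) :
  -1 < nu ->
  is_derive (v nu) z (cpow_series (alt_coeff (weighted_coeff (nu + 1) 1)) (z ^ 4)).
Proof.
  intros Hnu.
  apply (is_derive_ext (fun z => CSeries (fun n =>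
     RtoC ((-1) ^ n * v_coeff (nu + 1) n) * z ^ (4 * n + 1))%C)).
  { intros t. symmetry. now apply v_series. }
  replace (cpow_series (alt_coeff (weighted_coeff (nu + 1) 1)) (z ^ 4))
    with (CSeries (fun n => RtoC ((-1) ^ n * v_coeff (nu + 1) n * INR (4 * n + 1))
            * z ^ pred (4 * n + 1)))%C.
  - apply (is_derive_cseries _ (fun n => (4 * n + 1)%nat)). intros r Hr.
    assert (H := ex_series_weighted_coeff (nu + 1) (r ^ 4) 0 ltac:(lra) ltac:(now apply pow_le)).
    apply (ex_series_scal_l (V := R_NormedModule) r) in H.
    revert H. apply ex_series_ext. intros n.
    rewrite Rabs_mult, pow_1_abs, Rmult_1_l, Rabs_pos_eq
      by (apply Rlt_le, v_coeff_pos; lra).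
    change (r * (INR (4 * n + 1) ^ 0 * v_coeff (nu + 1) n * (r ^ 4) ^ n)
            = v_coeff (nu + 1) n * r ^ (4 * n + 1)).
    rewrite pow_add, pow_mult, pow_O, pow_1. ring.
  - apply CSeries_ext. intros n. rewrite <- Cpow_mult_r. unfold alt_coeff, weighted_coeff.
    f_equal; [f_equal; ring|f_equal; lia].
Qed.

Lemma mult_C_derive2_v (nu : R) (z : C) :
  -1 < nu ->
  (z * C_derive (C_derive (v nu)) z)%C
  = (RtoC 4 * cpow_series (alt_coeff (euler_coeff (weighted_coeff (nu + 1) 1))) (z ^ 4))%C.
Proof.
  intros Hnu.
  assert (HS : forall r, 0 <= r ->
    ex_series (fun n => Rabs (alt_coeff (weighted_coeff (nu + 1) 1) n) * r ^ (4 * n))).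
  { intros r Hr.
    assert (H := ex_series_weighted_coeff (nu + 1) (r ^ 4) 1 ltac:(lra) ltac:(now apply pow_le)).
    revert H. apply ex_series_ext. intros n. unfold alt_coeff.
    rewrite Rabs_mult, pow_1_abs, Rmult_1_l, Rabs_pos_eq
      by (apply Rlt_le, weighted_coeff_pos; lra).
    now rewrite pow_mult. }
  assert (HD := is_derive_cseries (alt_coeff (weighted_coeff (nu + 1) 1)) (fun n => (4 * n)%nat) z HS).
  cbv beta in HD.
  rewrite (is_C_derive_unique (C_derive (v nu)) z
    (CSeries (fun n => RtoC (alt_coeff (weighted_coeff (nu + 1) 1) n * INR (4 * n))
               * z ^ pred (4 * n)))%C).
  2: { revert HD. apply is_derive_ext. intros t.
       rewrite (is_C_derive_unique _ _ _ (is_derive_v nu t Hnu)).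
       apply CSeries_ext. intros n. now rewrite <- Cpow_mult_r. }
  assert (H1 := is_cseries_scal z _ _ (CSeries_correct _ (ex_cabs_derive _ _ z HS))).
  apply (is_cseries_scal (RtoC (/ 4))) in H1. cbv beta in H1.
  assert (H4 : RtoC 4 <> 0%C) by (intros E; injection E; lra).
  transitivity (RtoC 4 * (RtoC (/ 4) *
     (z * CSeries (fun n => RtoC (alt_coeff (weighted_coeff (nu + 1) 1) n * INR (4 * n))
               * z ^ pred (4 * n)))))%C.
  { rewrite RtoC_inv by lra. field. }
  f_equal. symmetry. apply is_cseries_unique. revert H1. apply is_cseries_ext. intros n.
  rewrite mult_INR, <- Cpow_mult_r. unfold alt_coeff, euler_coeff. rewrite !RtoC_mult.
  destruct n as [|n].
  - simpl. ring.
  - replace (4 * S n)%nat with (S (pred (4 * S n))) at 2 by lia.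
    rewrite Cpow_S, RtoC_inv by lra. simpl (INR 4).
    replace (RtoC (1 + 1 + 1 + 1)) with (RtoC 4) by (f_equal; ring). field.
Qed.

Definition convexity_series (a w : R) : R :=
  Series (fun n => alt_coeff (weighted_coeff a 2) n * w ^ n).

Lemma one_plus_mult_C_derive2_v (nu : R) (z : C) :
  -1 < nu ->
  (1 + z * C_derive (C_derive (v nu)) z / C_derive (v nu) z)%C
  = (1 + RtoC 4 * log_derivative (weighted_coeff (nu + 1) 1) (z ^ 4))%C.
Proof.
  intros Hnu. rewrite mult_C_derive2_v by assumption.
  rewrite (is_C_derive_unique _ _ _ (is_derive_v nu z Hnu)).
  unfold log_derivative, Cdiv. ring.
Qed.

Lemma Re_one_plus_log_derivative_sign (a r : R) :
  0 < a -> 0 <= r -> weighted_coeff a 1 1 * r < 1 ->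
  exists Q, 0 < Q /\
  Re (1 + RtoC 4 * log_derivative (weighted_coeff a 1) (RtoC r))%C = Q * convexity_series a r.
Proof.
  intros Ha Hr Hw.
  destruct (Re_log_derivative_sign (weighted_coeff a 1)
    (fast_decay_weighted_coeff a 1 Ha ltac:(lia)) 4 r Hr Hw)
    as (Q & HQ & E).
  exists Q. split; [exact HQ|]. rewrite E. f_equal. unfold convexity_series.
  apply Series_ext. intros n. unfold alt_coeff, weighted_coeff. rewrite INR_4n1. ring.
Qed.

(** On the disk the real part of 1 + z v''/v' is at least its value at z = y. *)
Lemma convex_in_disk_v (nu y : R) :
  -1 < nu -> 0 < y -> weighted_coeff (nu + 1) 1 1 * y ^ 4 < 1 ->
  0 < convexity_series (nu + 1) (y ^ 4) -> convex_in_disk (v nu) y.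
Proof.
  intros Hnu Hy Hw Hpos z Hz.
  assert (Hb := fast_decay_weighted_coeff (nu + 1) 1 ltac:(lra) ltac:(lia)).
  assert (Hz4 : Cmod (z ^ 4) <= y ^ 4).
  { rewrite Cmod_pow. apply pow_incr. split; [apply Cmod_ge_0|lra]. }
  assert (Hp := weighted_coeff_pos (nu + 1) 1 1 ltac:(lra)).
  assert (Hw' : weighted_coeff (nu + 1) 1 1 * Cmod (z ^ 4) < 1).
  { apply Rle_lt_trans with (2 := Hw). apply Rmult_le_compat_l; lra. }
  split.
  - rewrite (is_C_derive_unique _ _ _ (is_derive_v nu z Hnu)).
    now apply cpow_series_alt_neq_0.
  - rewrite one_plus_mult_C_derive2_v by assumption.
    destruct (Re_one_plus_log_derivative_sign (nu + 1) (y ^ 4)) as (Q & HQ & E);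
      [lra|apply pow_le; lra|exact Hw|].
    assert (M := Re_log_derivative_min _ Hb (z ^ 4) (y ^ 4) Hz4 Hw).
    rewrite re_plus, re_scal_l in *.
    assert (0 < Q * convexity_series (nu + 1) (y ^ 4)) by now apply Rmult_lt_0_compat.
    lra.
Qed.

(** At the real point y itself the quotient is negative. *)
Lemma convex_in_disk_v_le (nu y rho : R) :
  -1 < nu -> 0 < y -> weighted_coeff (nu + 1) 1 1 * y ^ 4 < 1 ->
  convexity_series (nu + 1) (y ^ 4) < 0 -> convex_in_disk (v nu) rho -> rho <= y.
Proof.
  intros Hnu Hy Hw Hneg Hc. apply Rnot_lt_le. intros Hlt.
  assert (Hcy : Cmod (RtoC y) < rho) by (rewrite Cmod_R, Rabs_pos_eq; lra).
  destruct (Hc _ Hcy) as [_ H].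
  rewrite one_plus_mult_C_derive2_v, <- RtoC_pow in H by assumption.
  destruct (Re_one_plus_log_derivative_sign (nu + 1) (y ^ 4)) as (Q & HQ & E);
    [lra|apply pow_le; lra|exact Hw|].
  rewrite E in H. nra.
Qed.

Lemma nth_root_pos (k : nat) (x : R) : 0 < nth_root k x.
Proof. apply exp_pos. Qed.

Lemma nth_root_pow (k : nat) (x : R) : (0 < k)%nat -> 0 < x -> nth_root k x ^ k = x.
Proof.
  intros Hk Hx. rewrite <- Rpower_pow by apply nth_root_pos.
  unfold nth_root. rewrite Rpower_mult, Rinv_l, Rpower_1; auto.
  apply not_0_INR. lia.
Qed.

Lemma pow_lt_inv (k : nat) (x y : R) : 0 <= y -> x ^ k < y ^ k -> x < y.
Proof.
  intros Hy H. apply Rnot_le_lt. intros Hle. apply (Rlt_not_le _ _ H).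
  now apply pow_incr.
Qed.

Lemma radius_of_convexity_v_lt (nu w y : R) :
  -1 < nu -> 0 < w -> weighted_coeff (nu + 1) 1 1 * w < 1 ->
  convexity_series (nu + 1) w < 0 -> 0 < y -> w < y ^ 4 ->
  Rbar_lt (radius_of_convexity (v nu)) (Finite y).
Proof.
  intros Hnu Hw Hb Hneg Hy Hwy.
  assert (E := nth_root_pow 4 w ltac:(lia) Hw).
  assert (Hr := nth_root_pos 4 w).
  apply Rbar_le_lt_trans with (Finite (nth_root 4 w)).
  - apply Lub_Rbar_correct. intros rho [_ Hc]. simpl.
    apply convex_in_disk_v_le with nu; auto; now rewrite E.
  - simpl. apply pow_lt_inv with 4%nat; [lra|]. now rewrite E.
Qed.

Lemma radius_of_convexity_v_gt (nu w y : R) :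
  -1 < nu -> 0 < w -> weighted_coeff (nu + 1) 1 1 * w < 1 ->
  0 < convexity_series (nu + 1) w -> y ^ 4 < w ->
  Rbar_lt (Finite y) (radius_of_convexity (v nu)).
Proof.
  intros Hnu Hw Hb Hpos Hwy.
  assert (E := nth_root_pow 4 w ltac:(lia) Hw).
  assert (Hr := nth_root_pos 4 w).
  apply Rbar_lt_le_trans with (Finite (nth_root 4 w)).
  - simpl. apply pow_lt_inv with 4%nat; [lra|]. now rewrite E.
  - apply Lub_Rbar_correct. split; [exact Hr|].
    apply convex_in_disk_v; auto; now rewrite E.
Qed.

(** * Signs at the Rayleigh points *)

(** The terms decrease from the second one on, but the first may be smaller than the
    second; so the alternating series test is applied to the series without its first
    two terms. *)
Lemma convexity_series_bounds (a w : R) :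
  0 < a -> 0 <= w -> weighted_coeff a 2 1 * w <= 4 ->
  let u n := weighted_coeff a 2 n * w ^ n in
  1 - u 1%nat + u 2%nat - u 3%nat <= convexity_series a w
    <= 1 - u 1%nat + u 2%nat - u 3%nat + u 4%nat.
Proof.
  intros Ha Hw H4 u.
  assert (Hu : ex_series u) by now apply ex_series_weighted_coeff.
  assert (Hu0 : forall n, 0 <= u n).
  { intros n. apply Rmult_le_pos; [now apply Rlt_le, weighted_coeff_pos|now apply pow_le]. }
  assert (Habs : forall n, Rabs (alt_coeff (weighted_coeff a 2) n * w ^ n) = u n).
  { intros n. unfold alt_coeff. rewrite !Rabs_mult, pow_1_abs, Rmult_1_l.
    rewrite !Rabs_pos_eq; auto; [now apply pow_le|now apply Rlt_le, weighted_coeff_pos]. }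
  assert (Hex : ex_series (fun n => alt_coeff (weighted_coeff a 2) n * w ^ n)).
  { apply ex_series_Rabs. revert Hu. apply ex_series_ext. intros n; now rewrite Habs. }
  set (f := fun n => alt_coeff (weighted_coeff a 2) n * w ^ n) in Hex.
  assert (Hex1 : ex_series (fun n => f (S n))) by now apply ex_series_incr_1 in Hex.
  assert (Hex2 : ex_series (fun n => f (S (S n))))
    by now apply (ex_series_incr_1 (fun n => f (S n))) in Hex1.
  assert (E : convexity_series a w = 1 - u 1%nat + Series (fun n => f (S (S n)))).
  { unfold convexity_series. fold f.
    rewrite (Series_incr_1 f), (Series_incr_1 (fun n => f (S n))); auto.
    unfold f, alt_coeff, u. rewrite weighted_coeff_0. simpl. ring. }
  set (U := fun n => u (S (S n))).
  assert (Hdec : Un_decreasing U).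
  { intros n. unfold U, u.
    assert (Hfd := proj2 (proj2 (fast_decay_weighted_coeff a 2 Ha ltac:(lia)))
                     (S (S n)) ltac:(lia)).
    assert (Hwn : 0 <= w ^ S (S n)) by now apply pow_le.
    assert (Hp := weighted_coeff_pos a 2 (S (S n)) Ha).
    rewrite <- (tech_pow_Rmult w (S (S n))).
    replace (weighted_coeff a 2 (S (S (S n))) * (w * w ^ S (S n)))
      with (weighted_coeff a 2 (S (S (S n))) * w * w ^ S (S n)) by ring.
    apply Rmult_le_compat_r; [exact Hwn|].
    apply Rle_trans with (weighted_coeff a 2 1 / 4 * weighted_coeff a 2 (S (S n)) * w).
    - now apply Rmult_le_compat_r.
    - nra. }
  assert (Hlim : Un_cv U 0).
  { apply is_lim_seq_Reals.
    apply (is_lim_seq_incr_1 (fun n => u (S n))), (is_lim_seq_incr_1 u).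
    exact (ex_series_lim_0 u Hu). }
  assert (Hcv : Un_cv (fun N => sum_f_R0 (tg_alt U) N) (Series (fun n => f (S (S n))))).
  { apply is_lim_seq_Reals.
    apply (is_lim_seq_ext (sum_n (fun n => f (S (S n))))).
    - intros n. rewrite sum_n_Reals. apply sum_eq. intros i Hi.
      unfold f, tg_alt, U, u, alt_coeff. simpl. ring.
    - exact (Series_correct _ Hex2). }
  destruct (alternated_series_ineq U _ 0 Hdec Hlim Hcv) as [L _].
  destruct (alternated_series_ineq U _ 1 Hdec Hlim Hcv) as [_ R].
  unfold tg_alt, U in L, R. simpl in L, R. rewrite E. lra.
Qed.

(** As t tends to 0, with s <= 0.43 t^2, the left side is of order -t^2 + 2 s, hence
    negative. For the whole range of t, multiply by y^3 with y = 1 - 3t + 3s and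
    write s = sg t^2: after division by t^2 an inequality in sg and t remains, whose
    worst case is sg = 0.43. *)
Lemma rayleigh_upper_neg (t s q x : R) :
  0 < t <= 81 / 1250 -> 0 < s <= 43 / 100 * t ^ 2 -> 0 <= q <= s / 50 ->
  x * (1 - 3 * t + 3 * s) = 1 - 2 * t ->
  1 - x + t * x ^ 2 - s * x ^ 3 + q * x ^ 4 < 0.
Proof.
  intros Ht Hs Hq Hx.
  set (y := 1 - 3 * t + 3 * s) in Hx. set (m := 1 - 2 * t) in Hx.
  assert (Hst : s <= 43 / 100 * (81 / 1250) * t) by nra.
  assert (Hy : 8 / 10 < y < 1) by (unfold y; lra).
  assert (Hx0 : 0 < x) by (unfold m in Hx; nra).
  assert (Hx1 : x <= 11 / 10) by (unfold m, y in *; nra).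
  (* The quartic term is absorbed by the cubic one: q x <= (1/50) (11/10) s. *)
  assert (Hqs : q * x ^ 4 <= 22 / 1000 * s * x ^ 3).
  { replace (q * x ^ 4) with (q * x * x ^ 3) by ring.
    apply Rmult_le_compat_r; [apply pow_le; lra|]. nra. }
  assert (G : 1 - x + t * x ^ 2 - 978 / 1000 * s * x ^ 3 < 0); [|lra].
  (* Multiplying by y^3 turns every x into x y = 1 - 2 t. *)
  apply Rmult_lt_reg_r with (y ^ 3); [apply pow_lt; lra|]. rewrite Rmult_0_l.
  replace ((1 - x + t * x ^ 2 - 978 / 1000 * s * x ^ 3) * y ^ 3)
    with (y ^ 3 - (x * y) * y ^ 2 + t * (x * y) ^ 2 * y - 978 / 1000 * s * (x * y) ^ 3) by ring.
  rewrite Hx.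
  replace (y ^ 3 - m * y ^ 2 + t * m ^ 2 * y - 978 / 1000 * s * m ^ 3)
    with (y * (3 * s - 12 * s * t + 9 * s ^ 2 - t ^ 2 + 4 * t ^ 3) - 978 / 1000 * s * m ^ 3)
    by (unfold y, m; ring).
  assert (Hm : 1 - 6 * t <= m ^ 3) by (unfold m; simpl; nra).
  assert (Hsm : s * (1 - 6 * t) <= s * m ^ 3) by (apply Rmult_le_compat_l; lra).
  assert (B : 3 * s - 12 * s * t + 9 * s ^ 2 - t ^ 2 + 4 * t ^ 3
              <= 3 * s - 117 / 10 * s * t - t ^ 2 + 4 * t ^ 3) by nra.
  set (sg := s / t ^ 2).
  assert (Ht2 : 0 < t ^ 2) by (apply pow_lt; lra).
  assert (Es : s = sg * t ^ 2) by (unfold sg; field; lra).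
  assert (Hsg : 0 < sg <= 43 / 100).
  { split; [apply Rdiv_lt_0_compat; lra|].
    apply Rmult_le_reg_r with (t ^ 2); auto. lra. }
  apply Rle_lt_trans with
    (y * (3 * s - 117 / 10 * s * t - t ^ 2 + 4 * t ^ 3) - 978 / 1000 * (s * (1 - 6 * t))).
  { assert (y * (3 * s - 12 * s * t + 9 * s ^ 2 - t ^ 2 + 4 * t ^ 3)
      <= y * (3 * s - 117 / 10 * s * t - t ^ 2 + 4 * t ^ 3)) by (apply Rmult_le_compat_l; lra).
    lra. }
  rewrite Es at 1 2 3.
  replace (y * (3 * (sg * t ^ 2) - 117 / 10 * (sg * t ^ 2) * t - t ^ 2 + 4 * t ^ 3) -
     978 / 1000 * (sg * t ^ 2 * (1 - 6 * t)))
    with (t ^ 2 * (y * (3 * sg - 117 / 10 * sg * t - 1 + 4 * t) - 978 / 1000 * sg * (1 - 6 * t))) by ring.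
  assert (G : y * (3 * sg - 117 / 10 * sg * t - 1 + 4 * t) - 978 / 1000 * sg * (1 - 6 * t) < 0); [|nra].
  destruct (Rle_lt_dec (3 * sg - 117 / 10 * sg * t - 1 + 4 * t) 0) as [N|P].
  - nra.
  - apply Rle_lt_trans with
      ((1 - 29 / 10 * t) * (3 * sg - 117 / 10 * sg * t - 1 + 4 * t)
       - 978 / 1000 * sg * (1 - 6 * t)).
    + apply Rplus_le_compat_r. apply Rmult_le_compat_r; [lra|]. unfold y. lra.
    + (* the expression increases with sg *)
      apply Rle_lt_trans with
        ((1 - 29 / 10 * t) * (3 * (43 / 100) - 117 / 10 * (43 / 100) * t - 1 + 4 * t)
         - 978 / 1000 * (43 / 100) * (1 - 6 * t)); [|nra].
      assert (0 <= (43 / 100 - sg) * ((1 - 29 / 10 * t) * (3 - 117 / 10 * t)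
                 - 978 / 1000 * (1 - 6 * t))); [|lra].
      apply Rmult_le_pos; nra.
Qed.

(** The condition on x means t x^2 = (x^2 - 1)/2, so 1 - x + t x^2 = (x - 1)^2 / 2,
    and s x^3 is at most 0.43 (x - 1)^2 (x + 1)^2 / (4 x), which is smaller since
    (x + 1)^2 is close to 4 x. *)
Lemma rayleigh_lower_pos (t s x : R) :
  0 < t <= 81 / 1250 -> 0 < s <= 43 / 100 * t ^ 2 ->
  0 < x -> x ^ 2 * (1 - 2 * t) = 1 ->
  0 < 1 - x + t * x ^ 2 - s * x ^ 3.
Proof.
  intros Ht Hs Hx Hx2.
  assert (H1 : 1 < x) by nra.
  assert (H2 : x <= 11 / 10) by nra.
  assert (Et : t * x ^ 2 = (x ^ 2 - 1) / 2) by nra.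
  assert (Hs3 : s * x ^ 3 <= 43 / 100 * (x ^ 2 - 1) ^ 2 / 4 / x).
  { apply Rmult_le_reg_r with x; [lra|].
    replace (43 / 100 * (x ^ 2 - 1) ^ 2 / 4 / x * x)
      with (43 / 100 * ((x ^ 2 - 1) / 2) ^ 2) by (field; lra).
    rewrite <- Et.
    replace (s * x ^ 3 * x) with (s * x ^ 4) by ring.
    replace (43 / 100 * (t * x ^ 2) ^ 2) with (43 / 100 * t ^ 2 * x ^ 4) by ring.
    apply Rmult_le_compat_r; [apply pow_le; lra|lra]. }
  assert (Hs4 : 43 / 100 * (x ^ 2 - 1) ^ 2 / 4 / x < (x - 1) ^ 2 / 2).
  { apply Rmult_lt_reg_r with x; [lra|].
    replace (43 / 100 * (x ^ 2 - 1) ^ 2 / 4 / x * x)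
      with ((x - 1) ^ 2 * (43 / 400 * (x + 1) ^ 2)) by (field; lra).
    replace ((x - 1) ^ 2 / 2 * x) with ((x - 1) ^ 2 * (x / 2)) by field.
    apply Rmult_lt_compat_l; [apply pow_lt; lra|]. nra. }
  rewrite Et. nra.
Qed.

(** * The bounds *)

(** These three are the normalized coefficients c_k / c_1^k, k = 2, 3, 4, of the
    convexity series, each written as a constant times the preceding ones and a rational
    function with values in (0, 1). *)
Definition ratio2 (a : R) : R := 81 / 1250 * (a ^ 2 / ((a + 2) * (a + 3))).
Definition ratio3 (a : R) : R :=
  8450 / 19683 * ratio2 a ^ 2 * ((a + 1) * (a + 3) / ((a + 4) * (a + 5))).
Definition ratio4 (a : R) : R :=
  289 / 16900 * ratio3 a * (a ^ 2 * (a + 1) / ((a + 3) * (a + 6) * (a + 7))).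

Lemma weighted_coeff_2_1 (a : R) : 0 < a -> weighted_coeff a 2 1 = 25 / (16 * a ^ 2 * (a + 1)).
Proof. intros Ha. rewrite weighted_coeff_1 by assumption. field. lra. Qed.

Lemma weighted_coeff_2_2 (a : R) :
  0 < a -> weighted_coeff a 2 2 = ratio2 a * weighted_coeff a 2 1 ^ 2.
Proof.
  intros Ha. rewrite weighted_coeff_2_1 by assumption.
  unfold weighted_coeff, v_coeff, ratio2. rewrite INR_4n1. simpl. field. repeat split; lra.
Qed.

Lemma weighted_coeff_2_3 (a : R) :
  0 < a -> weighted_coeff a 2 3 = ratio3 a * weighted_coeff a 2 1 ^ 3.
Proof.
  intros Ha. rewrite weighted_coeff_2_1 by assumption.
  unfold weighted_coeff, v_coeff, ratio3, ratio2. rewrite INR_4n1. simpl. field. repeat split; lra.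
Qed.

Lemma weighted_coeff_2_4 (a : R) :
  0 < a -> weighted_coeff a 2 4 = ratio4 a * weighted_coeff a 2 1 ^ 4.
Proof.
  intros Ha. rewrite weighted_coeff_2_1 by assumption.
  unfold weighted_coeff, v_coeff, ratio4, ratio3, ratio2. rewrite INR_4n1. simpl.
  field. repeat split; lra.
Qed.

Lemma quotient_bounds (x y : R) : 0 < x -> x < y -> 0 < x / y < 1.
Proof.
  intros Hx Hy. split; [apply Rdiv_lt_0_compat; lra|].
  apply Rmult_lt_reg_r with y; [lra|]. field_simplify; lra.
Qed.

Lemma ratio2_bounds (a : R) : 0 < a -> 0 < ratio2 a <= 81 / 1250.
Proof.
  intros Ha. unfold ratio2.
  destruct (quotient_bounds (a ^ 2) ((a + 2) * (a + 3))); [apply pow_lt; lra|nra|lra].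
Qed.

Lemma ratio3_bounds (a : R) : 0 < a -> 0 < ratio3 a <= 43 / 100 * ratio2 a ^ 2.
Proof.
  intros Ha. unfold ratio3.
  destruct (quotient_bounds ((a + 1) * (a + 3)) ((a + 4) * (a + 5))); [nra|nra|].
  assert (H2 : 0 < ratio2 a ^ 2) by (apply pow_lt, ratio2_bounds, Ha).
  split; [|nra]. apply Rmult_lt_0_compat; lra.
Qed.

Lemma ratio4_bounds (a : R) : 0 < a -> 0 <= ratio4 a <= ratio3 a / 50.
Proof.
  intros Ha. unfold ratio4.
  destruct (quotient_bounds (a ^ 2 * (a + 1)) ((a + 3) * (a + 6) * (a + 7)));
    [apply Rmult_lt_0_compat; [apply pow_lt|]; lra|nra|].
  assert (H2 := ratio3_bounds a Ha).
  split; [|nra]. apply Rmult_le_pos; lra.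
Qed.

Lemma continuous_neg_left (P : R -> R) (x : R) :
  0 < x -> continuous P x -> P x < 0 -> exists y, 0 < y < x /\ P y < 0.
Proof.
  intros Hx HP Hn.
  destruct (HP (fun z => z < 0) (open_lt 0 (P x) Hn)) as [d Hd].
  exists (x - Rmin (d / 2) (x / 2)).
  assert (Hm : 0 < Rmin (d / 2) (x / 2)) by (apply Rmin_pos; destruct d; simpl in *; lra).
  assert (H1 := Rmin_l (d / 2) (x / 2)). assert (H2 := Rmin_r (d / 2) (x / 2)).
  split; [lra|]. apply Hd.
  unfold ball; simpl; unfold AbsRing_ball, abs, minus, plus, opp; simpl.
  destruct d as [d Hd0]; simpl in *. apply Rabs_def1; lra.
Qed.

Lemma continuous_pos_right (P : R -> R) (x : R) :
  continuous P x -> 0 < P x -> exists y, x < y < x + 1 /\ 0 < P y.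
Proof.
  intros HP Hn.
  destruct (HP (fun z => 0 < z) (open_gt 0 (P x) Hn)) as [d Hd].
  exists (x + Rmin (d / 2) (1 / 2)).
  assert (Hm : 0 < Rmin (d / 2) (1 / 2)) by (apply Rmin_pos; destruct d; simpl in *; lra).
  assert (H1 := Rmin_l (d / 2) (1 / 2)). assert (H2 := Rmin_r (d / 2) (1 / 2)).
  split; [lra|]. apply Hd.
  unfold ball; simpl; unfold AbsRing_ball, abs, minus, plus, opp; simpl.
  destruct d as [d Hd0]; simpl in *. apply Rabs_def1; lra.
Qed.

Lemma convexity_series_normalized (a x : R) :
  0 < a -> 0 <= x <= 4 ->
  1 - x + ratio2 a * x ^ 2 - ratio3 a * x ^ 3
  <= convexity_series a (x / weighted_coeff a 2 1)
  <= 1 - x + ratio2 a * x ^ 2 - ratio3 a * x ^ 3 + ratio4 a * x ^ 4.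
Proof.
  intros Ha Hx. assert (Hc := weighted_coeff_pos a 2 1 Ha).
  assert (B := convexity_series_bounds a (x / weighted_coeff a 2 1) Ha).
  cbv beta zeta in B. rewrite weighted_coeff_2_2, weighted_coeff_2_3, weighted_coeff_2_4 in B
    by assumption.
  set (c := weighted_coeff a 2 1) in *.
  replace (c * (x / c) ^ 1) with x in B by (field; lra).
  replace (ratio2 a * c ^ 2 * (x / c) ^ 2) with (ratio2 a * x ^ 2) in B by (field; lra).
  replace (ratio3 a * c ^ 3 * (x / c) ^ 3) with (ratio3 a * x ^ 3) in B by (field; lra).
  replace (ratio4 a * c ^ 4 * (x / c) ^ 4) with (ratio4 a * x ^ 4) in B by (field; lra).
  apply B.
  - apply Rmult_le_pos; [lra|]. apply Rlt_le, Rinv_0_lt_compat, Hc.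
  - replace (c * (x / c)) with x by (field; lra). lra.
Qed.

Lemma weighted_coeff_1_1 (a : R) : 0 < a -> weighted_coeff a 1 1 = weighted_coeff a 2 1 / 5.
Proof. intros Ha. rewrite !weighted_coeff_1 by assumption. field. lra. Qed.

(** The strict inequality at the Rayleigh point persists slightly to the left of it,
    which makes the bound on the radius strict. *)
Lemma radius_of_convexity_v_lt_normalized (nu x y : R) :
  -1 < nu ->
  x * (1 - 3 * ratio2 (nu + 1) + 3 * ratio3 (nu + 1)) = 1 - 2 * ratio2 (nu + 1) ->
  0 < y -> x <= weighted_coeff (nu + 1) 2 1 * y ^ 4 ->
  Rbar_lt (radius_of_convexity (v nu)) (Finite y).
Proof.
  intros Hnu Hx Hy Hxy. set (a := nu + 1) in *. assert (Ha : 0 < a) by (unfold a; lra).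
  assert (Ht := ratio2_bounds a Ha). assert (Hs := ratio3_bounds a Ha).
  assert (Hq := ratio4_bounds a Ha). assert (Hc := weighted_coeff_pos a 2 1 Ha).
  assert (Hneg := rayleigh_upper_neg _ _ _ _ Ht Hs Hq Hx).
  assert (Hst : ratio3 a <= 43 / 100 * (81 / 1250) * ratio2 a) by nra.
  (* x <= 3/2 keeps x/5 = b_1 w below 1. *)
  assert (Hx0 : 0 < x <= 3 / 2) by (split; nra).
  destruct (continuous_neg_left (fun x => 1 - x + ratio2 a * x ^ 2 - ratio3 a * x ^ 3
    + ratio4 a * x ^ 4) x) as (x' & Hx' & Hneg'); auto; [lra| |].
  { apply (ex_derive_continuous (K := R_AbsRing) (V := R_NormedModule)). auto_derive. auto. }
  apply radius_of_convexity_v_lt with (x' / weighted_coeff a 2 1); fold a; auto.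
  - apply Rdiv_lt_0_compat; lra.
  - rewrite weighted_coeff_1_1 by assumption.
    replace (weighted_coeff a 2 1 / 5 * (x' / weighted_coeff a 2 1)) with (x' / 5) by (field; lra). lra.
  - destruct (convexity_series_normalized a x' Ha ltac:(lra)). lra.
  - apply Rmult_lt_reg_l with (weighted_coeff a 2 1); [exact Hc|].
    replace (weighted_coeff a 2 1 * (x' / weighted_coeff a 2 1)) with x' by (field; lra). lra.
Qed.

Lemma radius_of_convexity_v_gt_normalized (nu y : R) :
  -1 < nu -> 0 < y ->
  (weighted_coeff (nu + 1) 2 1 * y ^ 4) ^ 2 * (1 - 2 * ratio2 (nu + 1)) <= 1 ->
  Rbar_lt (Finite y) (radius_of_convexity (v nu)).
Proof.
  intros Hnu Hy Hyx. set (a := nu + 1) in *. assert (Ha : 0 < a) by (unfold a; lra).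
  assert (Ht := ratio2_bounds a Ha). assert (Hs := ratio3_bounds a Ha).
  assert (Hc := weighted_coeff_pos a 2 1 Ha).
  set (x := / sqrt (1 - 2 * ratio2 a)).
  assert (Hsq : 0 < sqrt (1 - 2 * ratio2 a)) by (apply sqrt_lt_R0; lra).
  assert (Hx0 : 0 < x) by now apply Rinv_0_lt_compat.
  assert (Hx : x ^ 2 * (1 - 2 * ratio2 a) = 1).
  { unfold x. rewrite <- (sqrt_sqrt (1 - 2 * ratio2 a)) at 2 by lra. field. lra. }
  assert (Hpos := rayleigh_lower_pos _ _ _ Ht Hs Hx0 Hx).
  assert (Hx1 : x <= 2) by nra.
  assert (Hy4 : 0 < y ^ 4) by now apply pow_lt.
  assert (Hyx' : weighted_coeff a 2 1 * y ^ 4 <= x).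
  { apply Rnot_lt_le. intros Hlt.
    assert (x ^ 2 < (weighted_coeff a 2 1 * y ^ 4) ^ 2) by (simpl; nra). nra. }
  destruct (continuous_pos_right (fun x => 1 - x + ratio2 a * x ^ 2 - ratio3 a * x ^ 3) x)
    as (x' & Hx' & Hpos'); auto.
  { apply (ex_derive_continuous (K := R_AbsRing) (V := R_NormedModule)). auto_derive. auto. }
  apply radius_of_convexity_v_gt with (x' / weighted_coeff a 2 1); fold a; auto.
  - apply Rdiv_lt_0_compat; lra.
  - rewrite weighted_coeff_1_1 by assumption.
    replace (weighted_coeff a 2 1 / 5 * (x' / weighted_coeff a 2 1)) with (x' / 5) by (field; lra). lra.
  - destruct (convexity_series_normalized a x' Ha ltac:(lra)). lra.
  - apply Rmult_lt_reg_l with (weighted_coeff a 2 1); [exact Hc|].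
    replace (weighted_coeff a 2 1 * (x' / weighted_coeff a 2 1)) with x' by (field; lra). lra.
Qed.

Lemma nu17_pos (nu : R) : -1 < nu -> 0 < nu17 nu.
Proof. intros Hnu. unfold nu17. nra. Qed.

(** In powers of nu + 1 all coefficients are positive. *)
Lemma nu18_pos (nu : R) : -1 < nu -> 0 < nu18 nu.
Proof.
  intros Hnu. set (a := nu + 1).
  assert (Ha : 0 < a) by (unfold a; lra).
  replace (nu18 nu) with (6336 * a ^ 5 + 108336 * a ^ 4 + 715725 * a ^ 3
    + 2251750 * a ^ 2 + 3343750 * a + 1875000) by (unfold nu18, a; ring).
  assert (0 < a ^ 2) by now apply pow_lt. assert (0 < a ^ 3) by now apply pow_lt.
  assert (0 < a ^ 4) by now apply pow_lt. assert (0 < a ^ 5) by now apply pow_lt. lra.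
Qed.

(** The quotient of the second and third power sums of the reciprocal zeros. *)
Lemma power_sum_ratio_23 (nu : R) :
  -1 < nu ->
  weighted_coeff (nu + 1) 2 1 * (8 * (nu + 1) * pochhammer (nu + 1) 3 * pochhammer (nu + 5) 2
     * nu17 nu / nu18 nu) * (1 - 3 * ratio2 (nu + 1) + 3 * ratio3 (nu + 1))
  = 1 - 2 * ratio2 (nu + 1).
Proof.
  intros Hnu. rewrite weighted_coeff_2_1 by lra. assert (H := nu18_pos nu Hnu).
  unfold nu18 in *. unfold nu17, ratio3, ratio2. simpl pochhammer. simpl INR.
  field. repeat split; lra.
Qed.

(** The quotient of the first and second power sums. *)
Lemma power_sum_ratio_12 (nu : R) :
  -1 < nu ->
  weighted_coeff (nu + 1) 2 1 * (16 * (25 * (nu + 1) * pochhammer (nu + 1) 4 / nu17 nu))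
    * (1 - 2 * ratio2 (nu + 1)) = 1.
Proof.
  intros Hnu. rewrite weighted_coeff_2_1 by lra. assert (H := nu17_pos nu Hnu).
  unfold nu17 in *. unfold ratio2. simpl pochhammer. simpl INR.
  field. repeat split; lra.
Qed.

(** The inverse of the second power sum, whose square root is the lower bound. *)
Lemma power_sum_2 (nu : R) :
  -1 < nu ->
  weighted_coeff (nu + 1) 2 1 ^ 2
    * (256 * (pochhammer (nu + 1) 4 * (nu + 1) ^ 3 * (nu + 2) / nu17 nu))
    * (1 - 2 * ratio2 (nu + 1)) = 1.
Proof.
  intros Hnu. rewrite weighted_coeff_2_1 by lra. assert (H := nu17_pos nu Hnu).
  unfold nu17 in *. unfold ratio2. simpl pochhammer. simpl INR.
  field. repeat split; lra.
Qed.

Theorem theorem16 (nu : R) (Hnu : -1 < nu) :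
  Rbar_lt (radius_of_convexity (v nu))
          (Finite (nth_root 4 (4 * (nu + 1) ^ 2 * (nu + 2) / 5)))
  /\
  (Rbar_lt (Finite (2 * nth_root 4 ((nu + 1) ^ 2 * (nu + 2) / 25)))
           (radius_of_convexity (v nu))
   /\
   Rbar_lt (radius_of_convexity (v nu))
           (Finite (2 * nth_root 4 (25 * (nu + 1) * pochhammer (nu + 1) 4
                                    / nu17 nu))))
  /\
  (Rbar_lt (Finite (2 * nth_root 8 (pochhammer (nu + 1) 4 * (nu + 1) ^ 3
                                    * (nu + 2) / nu17 nu)))
           (radius_of_convexity (v nu))
   /\
   Rbar_lt (radius_of_convexity (v nu))
           (Finite (nth_root 4 (8 * (nu + 1) * pochhammer (nu + 1) 3
                                * pochhammer (nu + 5) 2 * nu17 nu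
                                / nu18 nu)))).
Proof.
  assert (Ha : 0 < nu + 1) by lra.
  assert (Ht := ratio2_bounds (nu + 1) Ha). assert (Hs := ratio3_bounds (nu + 1) Ha).
  assert (Hc := weighted_coeff_pos (nu + 1) 2 1 Ha).
  assert (H17 := nu17_pos nu Hnu). assert (H18 := nu18_pos nu Hnu).
  assert (Hx := power_sum_ratio_23 nu Hnu). assert (HX2 := power_sum_ratio_12 nu Hnu).
  assert (HL := power_sum_2 nu Hnu).
  assert (P4 := pochhammer_pos (nu + 1) 4 Ha).
  assert (P3 := pochhammer_pos (nu + 1) 3 Ha).
  assert (P2 := pochhammer_pos (nu + 5) 2 ltac:(lra)).
  set (W3 := 8 * (nu + 1) * pochhammer (nu + 1) 3 * pochhammer (nu + 5) 2
                                * nu17 nu / nu18 nu) in *.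
  set (W2 := 25 * (nu + 1) * pochhammer (nu + 1) 4 / nu17 nu) in *.
  set (WL := pochhammer (nu + 1) 4 * (nu + 1) ^ 3 * (nu + 2) / nu17 nu) in *.
  assert (HW3 : 0 < W3).
  { unfold W3. apply Rdiv_lt_0_compat;
      repeat first [assumption|lra|apply pow_lt|apply Rmult_lt_0_compat]. }
  assert (HW2 : 0 < W2).
  { unfold W2. apply Rdiv_lt_0_compat;
      repeat first [assumption|lra|apply pow_lt|apply Rmult_lt_0_compat]. }
  assert (HWL : 0 < WL).
  { unfold WL. apply Rdiv_lt_0_compat;
      repeat first [assumption|lra|apply pow_lt|apply Rmult_lt_0_compat]. }
  assert (HW1 : 0 < (nu + 1) ^ 2 * (nu + 2)).
  { apply Rmult_lt_0_compat; [now apply pow_lt|lra]. }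
  assert (E1 : weighted_coeff (nu + 1) 2 1 * ((nu + 1) ^ 2 * (nu + 2)) = 25 / 16).
  { rewrite weighted_coeff_2_1 by assumption. field. lra. }
  set (t := ratio2 (nu + 1)) in *. set (s := ratio3 (nu + 1)) in *.
  set (c := weighted_coeff (nu + 1) 2 1) in *.
  split; [|split; split].
  - apply radius_of_convexity_v_lt_normalized with (c * W3); auto using nth_root_pos.
    fold c. rewrite nth_root_pow; [|lia|lra].
    replace (c * (4 * (nu + 1) ^ 2 * (nu + 2) / 5)) with (5 / 4) by lra.
    nra.
  - apply radius_of_convexity_v_gt_normalized; auto.
    { apply Rmult_lt_0_compat; [lra|apply nth_root_pos]. }
    fold c t. rewrite (Rpow_mult_distr 2), nth_root_pow; [|lia|lra].
    replace (c * (2 ^ 4 * ((nu + 1) ^ 2 * (nu + 2) / 25))) with 1 by lra. lra.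
  - apply radius_of_convexity_v_lt_normalized with (c * W3); auto.
    { apply Rmult_lt_0_compat; [lra|apply nth_root_pos]. }
    fold c. rewrite (Rpow_mult_distr 2), nth_root_pow; [|lia|lra].
    replace (2 ^ 4) with 16 by ring.
    apply Rmult_le_reg_r with ((1 - 2 * t) * (1 - 3 * t + 3 * s)); [nra|].
    replace (c * W3 * ((1 - 2 * t) * (1 - 3 * t + 3 * s)))
      with (c * W3 * (1 - 3 * t + 3 * s) * (1 - 2 * t)) by ring.
    replace (c * (16 * W2) * ((1 - 2 * t) * (1 - 3 * t + 3 * s)))
      with (c * (16 * W2) * (1 - 2 * t) * (1 - 3 * t + 3 * s)) by ring.
    rewrite Hx, HX2. nra.
  - apply radius_of_convexity_v_gt_normalized; auto.
    { apply Rmult_lt_0_compat; [lra|apply nth_root_pos]. }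
    fold c t.
    replace ((c * (2 * nth_root 8 WL) ^ 4) ^ 2) with (c ^ 2 * (256 * nth_root 8 WL ^ 8)) by ring.
    rewrite nth_root_pow; [lra|lia|lra].
  - apply radius_of_convexity_v_lt_normalized with (c * W3); auto using nth_root_pos.
    fold c. rewrite nth_root_pow; [lra|lia|lra].
Qed.
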